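(* An Abelian topological group $X$ is complete and has compact exponent if and only if $X$ is closed in each Hausdorff paratopological group containing $X$ as a topological subgroup.
   Context: All topological groups are assumed to be Hausdorff. A topological group is complete if it is complete in its two-sided uniformity. A topological group $X$ has compact exponent if for some positive integer $n$ the set $\{x^n:x\in X\}$ has compact closure in $X$. A paratopological group is a group endowed with a topology making the multiplication $(x,y)\mapsto xy$ jointly continuous (inversion need not be continuous). A paratopological group $Y$ contains $X$ as a topological subgroup if $X$ is a subgroup of $Y$ and the topology of $X$ is the subspace topology inherited from $Y$. *)

(* Defs.v *)
From HB Require Import structures.
From mathcomp Require Import all_boot all_order all_algebra.
From mathcomp Require Import all_classical topology.

Set Implicit Arguments.
Unset Strict Implicit.
Unset Printing Implicit Defensive.

Local Open Scope classical_set_scope.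
Local Open Scope group_scope.

(* The library only has commutative topological groups, written additively
   (topologicalZmodType); here a group may be non-commutative and its
   inversion discontinuous. *)
HB.mixin Record isParatopologicalGroup G & Topological G & Group G := {
  mulg_continuous : continuous (fun xy : G * G => xy.1 * xy.2)
}.

#[short(type="paratopologicalGroupType")]
HB.structure Definition ParatopologicalGroup :=
  {G of Topological G & Group G & isParatopologicalGroup G}.

HB.mixin Record ParatopologicalGroup_isTopologicalGroup G
    & ParatopologicalGroup G := {
  invg_continuous : continuous (fun x : G => x^-1)
}.

(* Not assumed to be Hausdorff. *)
#[short(type="topologicalGroupType")]
HB.structure Definition TopologicalGroup :=
  {G of ParatopologicalGroup G & ParatopologicalGroup_isTopologicalGroup G}.

(* [two_sided G] is G with its own topology and, as a uniform space, with the
   two-sided uniformity: the join of the left uniformity (x^-1 * y near 1) and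
   of the right one (x * y^-1 near 1). *)
Definition two_sided (G : Type) : Type := G.

Definition two_sided_entourage (G : topologicalGroupType) :
    set_system (two_sided G * two_sided G) :=
  filter_from (nbhs (1 : G))
    (fun U => [set xy : G * G | U (xy.1^-1 * xy.2) /\ U (xy.1 * xy.2^-1)]).

Section TwoSidedUniformity.
Variable G : topologicalGroupType.
Implicit Types (x y : G) (U : set G).

Lemma two_sided_entourage_filter : Filter (@two_sided_entourage G).
Proof.
apply: filter_from_filter; first by exists setT; exact: filterT.
move=> U V U1 V1; exists (U `&` V); first exact: filterI.
by move=> [x y] /= [[? ?] [? ?]].
Qed.

Lemma two_sided_entourage_diagonal (A : set (two_sided G * two_sided G)) :
  two_sided_entourage A -> (diagonal `<=` A)%relation.
Proof.
move=> [U U1 UA] [x y] /= xy; rewrite /diagonal /= in xy; subst y.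
by apply: UA => /=; rewrite mulVg mulgV; split; exact: nbhs_singleton.
Qed.

Lemma two_sided_entourage_inv (A : set (two_sided G * two_sided G)) :
  two_sided_entourage A -> two_sided_entourage (A^-1)%relation.
Proof.
move=> [U U1 UA]; exists (U `&` [set x | U x^-1]).
  apply: filterI => //.
  by have := @invg_continuous G 1; rewrite /continuous_at invg1; apply.
move=> [x y] /= [[Ul UlV] [Ur UrV]]; apply: UA => /=.
by move: UlV UrV; rewrite /= !invgM !invgK.
Qed.

Lemma nbhs1_split U : nbhs (1 : G) U ->
  exists2 V, nbhs (1 : G) V & forall x y, V x -> V y -> U (x * y).
Proof.
move=> U1; have := @mulg_continuous G (1, 1); rewrite /continuous_at /= mulg1.
move=> /(_ _ U1) [[V W] /= [V1 W1] VWU].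
exists (V `&` W); first exact: filterI.
by move=> x y [Vx _] [_ Wy]; apply: (VWU (x, y)).
Qed.

Lemma two_sided_entourage_split_ex (A : set (two_sided G * two_sided G)) :
  two_sided_entourage A ->
  exists2 B, two_sided_entourage B & (B \; B `<=` A)%relation.
Proof.
move=> [U /nbhs1_split[V V1 VU] UA].
exists [set xy : G * G | V (xy.1^-1 * xy.2) /\ V (xy.1 * xy.2^-1)].
  by exists V.
move=> [x z] [y /= [Vxy Vxy'] [Vyz Vyz']]; apply: UA => /=; split.
  by have := VU _ _ Vxy Vyz; rewrite mulgA mulgK.
by have := VU _ _ Vxy' Vyz'; rewrite mulgA mulgVK.
Qed.

Lemma two_sided_nbhsE :
  (nbhs : G -> set_system G) = nbhs_ (@two_sided_entourage G).
Proof.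
have mulg_cvg (f g : G -> G) (x a b : G) : f @ x --> a -> g @ x --> b ->
    f y * g y @[y --> x] --> a * b.
  move=> fa gb; apply: (@cvg_comp _ _ _ (fun y => (f y, g y))
    (fun xy : G * G => xy.1 * xy.2) _ (nbhs (a, b))); first exact: cvg_pair.
  exact: (@mulg_continuous G (a, b)).
have id_cvg (x : G) : id @ x --> x by exact: cvg_id.
apply/funext => x; apply/funext => A; apply/propext; split.
  move=> xA; exists [set xy : G * G | A (x * (xy.1^-1 * xy.2))].
    exists [set u | A (x * u)] => [|[y z] /= []//].
    have := mulg_cvg _ _ _ _ _ (cvg_cst x) (id_cvg 1).
    by rewrite mulg1; apply.
  by move=> y /xsectionP /=; rewrite mulgA mulgV mul1g.
move=> [B [U U1 UB] BA]; apply: (filterS (P := [set y | U (x^-1 * y) /\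
    U (x * y^-1)])).
  by move=> y Uxy; apply/BA/mem_set/UB.
apply: filterI.
  have := mulg_cvg _ _ _ _ _ (cvg_cst x^-1) (id_cvg x).
  by rewrite mulVg; apply.
have := mulg_cvg _ _ _ _ _ (cvg_cst x) (@invg_continuous G x).
by rewrite mulgV; apply.
Qed.

HB.instance Definition _ := Topological.copy (two_sided G) G.
HB.instance Definition _ := isPointed.Build (two_sided G) (1 : G).
HB.instance Definition _ := Nbhs_isUniform_mixin.Build (two_sided G)
  two_sided_entourage_filter two_sided_entourage_diagonal
  two_sided_entourage_inv two_sided_entourage_split_ex two_sided_nbhsE.

End TwoSidedUniformity.

Definition complete_group (G : topologicalGroupType) : Prop :=
  forall F : set_system (two_sided G), ProperFilter F -> cauchy F -> cvg F.

Definition compact_exponent (G : topologicalGroupType) : Prop :=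
  exists2 n : nat, (0 < n)%N & compact (closure (range (fun x : G => x ^+ n))).

(* f identifies X with a subgroup of Y carrying the subspace topology. *)
Definition topological_subgroup_embedding
    (X : topologicalGroupType) (Y : paratopologicalGroupType)
    (f : X -> Y) : Prop :=
  [/\ {morph f : x y / x * y}, injective f &
      forall U : set X, open U <-> exists2 V : set Y, open V & U = f @^-1` V].

(* Main.v *)
Require Import Defs.
From HB Require Import structures.
From mathcomp Require Import all_boot all_order all_algebra.
From mathcomp Require Import all_fingroup algC archimedean classfun character.
From mathcomp Require Import all_classical topology.
From mathcomp Require Import zify ring.

Set Implicit Arguments.
Unset Strict Implicit.
Unset Printing Implicit Defensive.

Import Order.TTheory GRing.Theory Num.Theory.
Local Open Scope ring_scope.

(** If the powers [x ^ n] stay in a compact subset [K] of [X], then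
    [a * b^-1 = a * b ^ n.-1 * (b ^ n)^-1] tends to [1] when [a] and [b] tend to
    a point [y] of the closure of [X] in [Y]: indeed [b ^ n] tends to [y ^ n], which
    lies in [K], and the inversion is continuous on [X]. Hence the trace on [X] of the
    neighbourhoods of [y] is a Cauchy filter, and [y] is in [X] when [X] is complete.

    Conversely, write [X] additively. One adjoins a limit [y] to [X], topologizing
    the group [X * int] generated by [X] and [y] (modulo the closure of [0]).
    If [X] is not complete, [y] is the limit of a divergent Cauchy filter. If [X] is
    complete but not of compact exponent, no [nX] with [n > 0] is totally bounded,
    and [y] is a limit of a sequence [x]: a neighbourhood of [0] contains
    the [u + \sum_i k_i (x_i - y)] with [u] small and [0 <= k_i <= 2 ^ (i - n)]. Since
    the [k_i] are nonnegative, no new neighbourhood of [0] appears in [X]; this is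
    where the discontinuity of the inversion is used. For this topology to be Hausdorff,
    if [a] in [X] is a limit of sums [\sum_i k_i x_i] with [k_i] in [int] of constant
    total [\sum_i k_i = m], then [a] and [m] must vanish.
    A generic choice of [x] forces all the [k_i] to be divisible by every "good" [d],
    that is, every [d] such that [cX] is totally bounded modulo [dX] for no [c]
    outside [d * int]. If [0] is good, nothing else is needed. Otherwise every
    neighbourhood of [0] has a good [g] such that [gX] is totally bounded with respect
    to it; Bogolyubov's lemma (in finite groups [(Z/M)^n], transferred to [X] by
    simultaneous recurrence) then shows that [\sum_i k_i x_i] with [g | k_i] is small as
    soon as finitely many (ultraproducts of) characters of the free group on the [x_i]
    are close to [1] at [k], and these constraints can be imposed on the
    neighbourhoods of [0], as every sequence in a circle clusters along an
    ultrafilter. *)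

(** * Bogolyubov's lemma in finite abelian groups *)

Section Bogolyubov.
Variable gT : finGroupType.
Let G := [set: gT]%G.
Hypothesis abelG : abelian G.

Let chiM i (x y : gT) : 'chi[G]_i (x * y)%g = 'chi_i x * 'chi_i y.
Proof. by rewrite lin_charM ?inE //; apply/char_abelianP. Qed.

(** By orthonormality of the characters, the sum is the inner product of [F = \sum_i u i *: 'chi_i]
    with its translate by [g], so some term of this product is nonzero. *)
Lemma positive_type_support (u : Iirr G -> algC) (g : gT) :
  \sum_i `|u i| ^+ 2 * 'chi[G]_i g != 0 ->
  exists2 y, (\sum_i u i *: 'chi[G]_i) y != 0 &
             (\sum_i u i *: 'chi[G]_i) (g * y)%g != 0.
Proof.
pose F := \sum_i u i *: 'chi[G]_i; rewrite -/F => nz.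
pose Fg := \sum_i (u i * 'chi_i g) *: 'chi[G]_i.
have FgE y : Fg y = F (g * y)%g.
  rewrite /Fg /F !sum_cfunE; apply: eq_bigr => i _.
  by rewrite !cfunE chiM mulrA.
have coefE (v : Iirr G -> algC) i : '[\sum_j v j *: 'chi[G]_j, 'chi_i] = v i.
  rewrite cfdot_suml (bigD1 i) //= cfdotZl cfdot_irr eqxx mulr1 big1 ?addr0 //.
  by move=> j ji; rewrite cfdotZl cfdot_irr (negbTE ji) mulr0.
have dotE : '[Fg, F] = \sum_i `|u i| ^+ 2 * 'chi_i g.
  rewrite cfdot_sum_irr; apply: eq_bigr => i _.
  by rewrite !coefE normCK mulrAC.
have: '[Fg, F] != 0 by rewrite dotE.
rewrite cfdotE mulf_eq0 negb_or => /andP[_ sum_n0].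
have /existsP[y] : [exists y, Fg y * (F y)^* != 0].
  apply: contraNT sum_n0; rewrite negb_exists => /forallP all0.
  by rewrite big1 // => y _; apply/eqP; rewrite -[_ == _]negbK all0.
rewrite mulf_eq0 negb_or FgE conjC_eq0 => /andP[gy y0].
by exists y.
Qed.

(** The [chi k] are the characters at which the Fourier coefficient of the indicator of [A] is
    large; Parseval's identity bounds their number by [2 * r ^ 2]. *)
Lemma bogolyubov (A : {set gT}) (r : nat) : (#|gT| <= r * #|A|)%N ->
  exists chi : nat -> gT -> algC,
    [/\ forall k x, `|chi k x| = 1,
        forall k, {morph chi k : x y / (x * y)%g >-> x * y} &
        forall g, (forall k, (k < 2 * r ^ 2)%N -> `|chi k g - 1| <= 1) ->
          exists a b c d, [/\ a \in A, b \in A, c \in A, d \in A &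
                            g = (a * b * c^-1 * d^-1)%g]].
Proof.
move=> leGA.
have nAG : (A <| G)%g.
  by rewrite /normal finset.subsetT sub_abelian_norm // finset.subsetT.
have linchi i : 'chi[G]_i \is a linear_char by apply/char_abelianP.
have chiN i x : `|'chi[G]_i x| = 1 by rewrite normC_lin_char ?inE.
pose f : 'CF(G) := '1_A.
have fE x : f x = (x \in A)%:R by rewrite cfuniE.
pose a i := '[f, 'chi[G]_i].
pose b i := `|a i| ^+ 2.
have b0 i : 0 <= b i by rewrite exprn_ge0.
have bN i : `|b i| = b i by rewrite ger0_norm.
pose al : algC := #|A|%:R / #|G|%:R.
have cardG : #|G| = #|gT| by rewrite cardsT.
have Ggt0 : (0 < #|gT|)%N by rewrite -cardG cardG_gt0.
have rA : (0 < r * #|A|)%N := leq_trans Ggt0 leGA.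
have al0 : 0 < al.
  rewrite divr_gt0 ?ltr0n ?cardG_gt0 //.
  by move: rA; rewrite muln_gt0 => /andP[].
have ral : 1 <= r%:R * al.
  rewrite /al mulrA ler_pdivlMr ?ltr0n ?cardG_gt0 // mul1r -natrM ler_nat.
  by rewrite cardG.
have sumb : \sum_i b i = al.
  rewrite -[RHS](_ : '[f, f] = _); last by rewrite cfdot_cfuni // finset.setIid.
  by rewrite cfdot_sum_irr; apply: eq_bigr => i _; rewrite /b normCK.
have a0 : a 0 = al.
  rewrite /a irr0 -cfuniG cfdot_cfuni ?normal_refl //.
  by rewrite (finset.setIidPl _) ?finset.subsetT.
pose S := [set i | al ^+ 3 / 2 <= b i].
have leS : (#|S| <= 2 * r ^ 2)%N.
  have : #|S|%:R * (al ^+ 3 / 2) <= al.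
    rewrite -[leRHS]sumb mulr_natl -sumr_const [leRHS](bigID (mem S)) /=.
    rewrite -[leLHS]addr0 lerD ?sumr_ge0 // ler_sum // => i.
    by rewrite inE.
  have -> : #|S|%:R * (al ^+ 3 / 2) = (#|S|%:R * al ^+ 2 / 2) * al.
    by rewrite exprSr; field.
  rewrite ger_pMl // ler_pdivrMr ?ltr0n // mul1r => leS.
  rewrite -(ler_nat algC) natrM natrX.
  have: #|S|%:R * 1 <= (#|S|%:R : algC) * (r%:R * al) ^+ 2.
    by rewrite ler_wpM2l ?ler0n // exprn_ege1.
  rewrite mulr1 => /le_trans-> //.
  rewrite exprMn mulrCA mulrC ler_wpM2r //.
  by rewrite exprn_ge0 ?ler0n.
exists (fun k x => 'chi[G]_(nth 0 (enum S) k) x); split=> // [k x y|g gS].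
  exact: chiM.
have ReS i : i \in S -> 0 <= 'Re ('chi[G]_i g).
  move=> iS; have := gS (index i (enum S)); rewrite nth_index ?mem_enum //.
  have iS' : (index i (enum S) < 2 * r ^ 2)%N.
    by rewrite (leq_trans _ leS) // cardE index_mem mem_enum.
  move=> /(_ iS') le1.
  have : `|'chi[G]_i g - 1| ^+ 2 <= 1 by rewrite exprn_ile1.
  have : `|'chi[G]_i g| ^+ 2 = 1 by rewrite chiN expr1n.
  rewrite !normC2_Re_Im !raddfB /= (Creal_ReP 1 _) ?rpred1 //.
  rewrite (Creal_ImP 1 _) ?rpred1 // subr0.
  have := Creal_Re ('chi[G]_i g); have := Creal_Im ('chi[G]_i g).
  set x := 'Re _; set y := 'Im _ => yR xR xy1.
  have -> : (x - 1) ^+ 2 + y ^+ 2 = 2 - 2 * x.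
    by rewrite (_ : 2 = 1 + 1) // -{2}xy1; ring.
  rewrite lerBlDr -lerBlDl (_ : 2 - 1 = 1); last by ring.
  by move=> /(le_trans ler01); rewrite pmulr_rge0.
have RegeN1 i : -1 <= 'Re ('chi[G]_i g).
  rewrite lerNl -raddfN /= -(chiN i g) -normrN.
  by have [] := leif_Re_Creal (- 'chi[G]_i g).
have supp x : (\sum_i b i *: 'chi[G]_i) x != 0 ->
    exists2 y, y \in A & (x * y)%g \in A.
  rewrite sum_cfunE => nz.
  have [|y] := @positive_type_support a x.
    rewrite [X in X != 0](_ : _ = \sum_i (b i *: 'chi[G]_i) x) //.
    by apply: eq_bigr => i _; rewrite cfunE.
  rewrite -cfun_sum_cfdot !fE !pnatr_eq0 !eqb0 !negbK => yA xyA.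
  by exists y.
(* The real part is at least [al ^+ 4 / 2]: the trivial character contributes [al ^+ 4], the others
   in [S] contribute nonnegatively, and those outside lose at most [al ^+ 3 / 2] times
   [\sum_i b i = al]. *)
have nz : \sum_i `|b i| ^+ 2 * 'chi[G]_i g != 0.
  apply/eqP => /(congr1 (fun z => 'Re z)); rewrite raddf_sum raddf0 /=.
  have al3 : 0 <= al ^+ 3 / 2 by rewrite divr_ge0 // exprn_ge0 // ltW.
  rewrite (eq_bigr (fun i => b i ^+ 2 * 'Re ('chi_i g))); last first.
    by move=> i _; rewrite ReMl ?bN // rpredX // ger0_real.
  apply/eqP; rewrite gt_eqF // (bigD1 0) //= irr0 cfun1E inE.
  rewrite (Creal_ReP 1 _) ?rpred1 // mulr1 /b a0 (gtr0_norm al0) -/b.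
  have low i : - (b i * (al ^+ 3 / 2)) <= b i ^+ 2 * 'Re ('chi_i g).
    have [iS|] := boolP (i \in S).
      apply: (@le_trans _ _ 0); first by rewrite oppr_le0 mulr_ge0.
      by rewrite mulr_ge0 ?exprn_ge0 // ReS.
    rewrite inE -real_ltNge ?ger0_real // => bi.
    rewrite expr2 -mulrA -mulrN ler_wpM2l //.
    apply: (@le_trans _ _ (- b i)); first by rewrite lerN2 ltW.
    by rewrite -mulrN1 ler_wpM2l.
  have : - (al * (al ^+ 3 / 2)) <= \sum_(i | i != 0) b i ^+ 2 * 'Re ('chi[G]_i g).
    rewrite -{1}sumb mulr_suml -sumrN.
    rewrite [leLHS](bigD1 0) //= -[leRHS]add0r lerD //.
      by rewrite oppr_le0 mulr_ge0.
    by apply: ler_sum => i _; exact: low.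
  move=> /(lerD (lexx ((al ^+ 2) ^+ 2))) /lt_le_trans-> //.
  have -> : al ^+ 2 ^+ 2 - al * (al ^+ 3 / 2) = al ^+ 4 / 2 by field.
  by rewrite divr_gt0 // exprn_gt0.
(* The support argument is used twice: on [b], to write [g] as a quotient of two points of a
   support, then on [a], to write each of these as a quotient of points of [A]. *)
have [y /supp[c cA ycA] /supp[d dA gydA]] := positive_type_support nz.
exists (g * y * d)%g, c, (y * c)%g, d; split => //.
have C (u v : gT) : (u * v = v * u)%g by apply: (centsP abelG); rewrite !inE.
by rewrite invMg !mulgA mulgK -(mulgA g) (C y d) mulgA !mulgK.
Qed.
End Bogolyubov.

Local Open Scope classical_set_scope.

(** * Identities in abelian groups *)

Inductive zexp := ZAtom of nat | Zzero | Zadd of zexp & zexp | Zopp of zexp.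

Fixpoint zcoef (e : zexp) (i : nat) : int :=
  match e with
  | ZAtom j => (i == j)%:Z
  | Zzero => 0
  | Zadd a b => zcoef a i + zcoef b i
  | Zopp a => - zcoef a i
  end.

Fixpoint zeval (X : zmodType) (env : seq X) (e : zexp) : X :=
  match e with
  | ZAtom j => nth 0 env j
  | Zzero => 0
  | Zadd a b => zeval env a + zeval env b
  | Zopp a => - zeval env a
  end.

Lemma zevalE (X : zmodType) (env : seq X) e :
  zeval env e = \sum_(i < size env) env`_i *~ zcoef e i.
Proof.
elim: e => [j||a IHa b IHb|a IHa] /=.
- have [jn|nj] := ltnP j (size env); last first.
    rewrite nth_default // big1 // => i _.
    by rewrite (_ : (i == j :> nat) = false) //; apply/negbTE; move: (ltn_ord i); lia.
  rewrite (bigD1 (Ordinal jn)) //= eqxx mulr1z big1 ?addr0 // => i /negbTE ij.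
  by rewrite -(inj_eq val_inj) /= in ij; rewrite ij mulr0z.
- by rewrite big1 // => i _; rewrite mulr0z.
- by rewrite IHa IHb -big_split; apply: eq_bigr => i _; rewrite mulrzDr.
- by rewrite IHa -sumrN; apply: eq_bigr => i _; rewrite mulrNz.
Qed.

Lemma zevalP (X : zmodType) (env : seq X) a b :
  all (fun i => zcoef a i == zcoef b i) (iota 0 (size env)) ->
  zeval env a = zeval env b.
Proof.
move=> /allP ab; rewrite !zevalE; apply: eq_bigr => i _.
by rewrite (eqP (ab _ _)) // mem_iota /= ltn_ord.
Qed.

(* [zmodule] compares the integer coefficients of the atoms on both sides. Atoms
   are identified up to unification, as the canonical instances of an operation
   may be reached by different paths in the hierarchy. *)
Ltac zsame t u := match goal with _ => unify t u end.
Ltac zmem t env :=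
  match env with
  | ?u :: _ => let _ := zsame t u in constr:(true)
  | _ :: ?env' => zmem t env'
  | _ => constr:(false)
  end.
Ltac zenv t env :=
  lazymatch t with
  | ?a + ?b => let env' := zenv a env in zenv b env'
  | - ?a => zenv a env
  | 0 => env
  | _ =>
      lazymatch zmem t env with
      | true => env
      | false =>
          lazymatch type of env with seq ?T => constr:(@cons T t env) end
      end
  end.
Ltac zindex t env :=
  match env with
  | ?u :: _ => let _ := zsame t u in constr:(O)
  | _ :: ?env' => let n := zindex t env' in constr:(S n)
  end.
Ltac zreify t env :=
  lazymatch t with
  | ?a + ?b =>
      let x := zreify a env in let y := zreify b env in constr:(Zadd x y)
  | - ?a => let x := zreify a env in constr:(Zopp x)
  | 0 => constr:(Zzero)
  | _ => let n := zindex t env in constr:(ZAtom n)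
  end.
Ltac zmodule_in T :=
  lazymatch goal with
  | |- ?a = ?b =>
      let env := zenv a (@nil T) in let env := zenv b env in
      let zlhs := zreify a env in let zrhs := zreify b env in
      refine (@zevalP _ env zlhs zrhs _); vm_compute; reflexivity
  end.
Ltac zmodule := lazymatch goal with |- @eq ?T _ _ => zmodule_in T end.

(** * Totally bounded subgroups and generic sequences *)

Section Thin.
Variable X : zmodType.

(** Equivalently, [S - S] is not syndetic: no finitely many of its translates cover [X]. *)
Definition thin (S : set X) : Prop :=
  forall F : seq X, exists z,
    forall f s s', f \in F -> S s -> S s' -> z <> f + s - s'.

(* As in Neumann's lemma on coverings by cosets: if [z + S i] is disjoint from
   [F + S i], then [S i] may be replaced by translates of the other sets. *)
Lemma avoid_thin_translates (I : eqType) (r : seq I) (S : I -> set X) :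
  (forall i, i \in r -> thin (S i)) ->
  forall F : seq X, exists x, forall i f, i \in r -> f \in F -> ~ S i (x - f).
Proof.
elim: r => [|i r IHr] thinS F; first by exists 0.
have [z zP] := thinS i (mem_head _ _) F.
have [|x xP] := IHr _ (F ++ [seq f + g - z | f <- F, g <- F]).
  by move=> j jr; apply: thinS; rewrite inE jr orbT.
have [xF|] := pselect (forall f, f \in F -> ~ S i (x - f)).
  exists x => j f; rewrite inE => /predU1P[->|jr] fF; first exact: xF.
  by apply: xP; rewrite // mem_cat fF.
move=> /existsNP[f /not_implyP[fF /contrapT Sxf]].
exists (z + (x - f)) => j g; rewrite inE => /predU1P[->|jr] gF.
  move=> Sg; apply: (zP _ _ _ gF Sg Sxf).
  by zmodule.
rewrite (_ : _ - g = x - (f + g - z)).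
  apply: xP => //; rewrite mem_cat; apply/orP; right.
  by apply/allpairsP; exists (f, g).
by zmodule.
Qed.

End Thin.

(** A group topology enters only through its filter of neighbourhoods of 0; separation is not
    included. *)
Record group_nbhs0 (X : zmodType) (N : set_system X) : Prop := GroupNbhs0 {
  nbhs0_filter : Filter N;
  nbhs0_mem : forall U, N U -> U 0;
  nbhs0_split : forall U, N U -> exists2 V, N V &
    forall x y, V x -> V y -> U (x + y);
  nbhs0_opp : forall U, N U -> N [set x | U (- x)] }.

Existing Class group_nbhs0.
#[local] Existing Instance nbhs0_filter.

Section TotallyBounded.
Variables (X : zmodType) (N : set_system X).
Hypothesis grN : group_nbhs0 N.
Implicit Types (U V W : set X) (x y : X).

Lemma nbhs0_split_sym U : N U -> exists V, [/\ N V,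
  forall x, V x -> V (- x) & forall x y, V x -> V y -> U (x + y)].
Proof.
move=> /(nbhs0_split grN)[V NV VU]; exists (V `&` [set x | V (- x)]); split.
- by apply: filterI => //; exact: (nbhs0_opp grN).
- by move=> x [Vx Vx']; split => //=; rewrite opprK.
- by move=> x y [Vx _] [Vy _]; exact: VU.
Qed.

Definition tbounded (c : nat) U : Prop :=
  exists F : seq X, forall x, exists2 f, f \in F & U (x *+ c - f).

(** The set [U + dX], so that [tbounded c (thicken U d)] is total boundedness of [cX] modulo [dX] at
    the scale [U]. *)
Definition thicken U (d : nat) : set X := [set x | exists w, U (x - w *+ d)].

Lemma sub_tbounded c U V : U `<=` V -> tbounded c U -> tbounded c V.
Proof.
move=> UV [F FU]; exists F => x; have [f fF /UV] := FU x.
by exists f.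
Qed.

Lemma sub_thicken U V d : U `<=` V -> thicken U d `<=` thicken V d.
Proof. by move=> UV x [w /UV]; exists w. Qed.

Lemma thicken_base U d : U `<=` thicken U d.
Proof. by move=> x Ux; exists 0; rewrite mul0rn subr0. Qed.

Lemma thicken_add U d x w : thicken U d x -> thicken U d (x + w *+ d).
Proof. move=> [v Uv]; exists (v + w); move: Uv; congr U; rewrite mulrnDl; zmodule. Qed.

(** One [V] must serve all [c]. For [d = 0] it says that no [cX] with [0 < c] is totally bounded
    with respect to [V]. *)
Definition good (d : nat) : Prop := exists2 V, N V &
  forall c, ~~ (d %| c)%N -> ~ tbounded c (thicken V d).

Lemma tbounded_trans (U V : set X) c d n :
  (forall x y, V x -> V y -> U (x + y)) ->
  tbounded c (thicken V d) -> tbounded d (thicken V n) ->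
  tbounded c (thicken U n).
Proof.
move=> VU [F FP] [F' F'P]; exists [seq f + f' | f <- F, f' <- F'] => x.
have [f fF [w Vw]] := FP x; have [f' f'F' [w' Vw']] := F'P w.
exists (f + f'); first exact: allpairs_f.
exists w'; have := VU _ _ Vw Vw'; congr U.
zmodule.
Qed.

(** By Bezout, [x *+ gcdn d c] is modulo [dX] a multiple by [c]. *)
Lemma tbounded_gcd V c d : (0 < d)%N ->
  tbounded c (thicken V d) -> tbounded (gcdn d c) (thicken V d).
Proof.
move=> d0 [F FP]; exists F => x; case: (egcdnP c d0) => km kn eqk _.
have [f fF [w Vw]] := FP (- (x *+ kn)); exists f => //.
exists (x *+ km + w); move: Vw; congr V.
by rewrite mulNrn mulrnDl -!mulrnA eqk mulrnDr; zmodule.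
Qed.

(* If [nX] is totally bounded with respect to a small [V], the least [g] such that
   [gX] is totally bounded modulo [nX] is good. *)
Lemma good_exists : (forall U, N U -> exists2 n, (0 < n)%N & tbounded n U) ->
  forall U, N U -> exists g, [/\ (0 < g)%N, good g & tbounded g U].
Proof.
move=> tbN U NU; have [V NV VU] := nbhs0_split grN NU.
have [n n0 tbn] := tbN _ NV.
pose P c := `[< (0 < c)%N /\ forall W, N W -> tbounded c (thicken W n) >].
have Pn : P n.
  apply/asboolP; split=> // W NW; exists [:: 0] => x; exists 0; rewrite ?inE //.
  by exists x; rewrite subr0 subrr; exact: (nbhs0_mem grN) NW.
case: (ex_minnP (ex_intro _ n Pn)) => g /asboolP[g0 gP] gmin.
exists g; split=> //; last first.
  have : tbounded g (thicken V n) by exact: gP.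
  move=> [F FP]; have [F' F'P] := tbn.
  exists [seq f + f' | f <- F, f' <- F'] => x.
  have [f fF [w Vw]] := FP x; have [f' f'F' Vw'] := F'P w.
  exists (f + f'); first exact: allpairs_f.
  by have := VU _ _ Vw Vw'; congr U; zmodule.
apply: contrapT => ngood.
have tbc V' : N V' -> exists c : 'I_g, (0 < c)%N /\ tbounded c (thicken V' g).
  move=> NV'; apply: contrapT => nc; apply: ngood; exists V' => // c ngc tb.
  have lt_g : (gcdn g c < g)%N.
    rewrite ltn_neqAle dvdn_leq ?dvdn_gcdl // andbT.
    by apply: contra ngc => /eqP <-; exact: dvdn_gcdr.
  apply: nc; exists (Ordinal lt_g); split; first by rewrite gcdn_gt0 g0.
  exact: tbounded_gcd.
(* Only finitely many [c] lie below [g], so one of them serves every [V']: otherwise the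
   intersection of one bad [V'] per [c] contradicts [tbc]. *)
have [c c0 cP] : exists2 c : 'I_g, (0 < c)%N &
    forall V', N V' -> tbounded c (thicken V' g).
  apply: contrapT => nc.
  have bad (c : 'I_g) : exists V', N V' /\
      ((0 < c)%N -> ~ tbounded c (thicken V' g)).
    apply: contrapT => nV; apply: nc; exists c.
      rewrite lt0n; apply/eqP => c0; apply: nV; exists setT.
      by split; [exact: filterT|rewrite c0].
    move=> V' NV'; apply: contrapT => ntb; apply: nV; exists V'.
    by split.
  have [V' V'P] := choice bad.
  have NI : N [set x | forall c, V' c x].
    by apply: filter_forall => c; have [] := V'P c.
  have [c [c0 tb]] := tbc _ NI; have [_ /(_ c0)] := V'P c; apply.
  apply: sub_tbounded tb; apply: sub_thicken => x; exact.
have: P c.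
  apply/asboolP; split=> // W NW; have [V' NV' V'W] := nbhs0_split grN NW.
  exact: tbounded_trans V'W (cP _ NV') (gP _ NV').
by move=> /gmin; rewrite leqNgt ltn_ord.
Qed.

(** Multiplication by [c] sends a difference of two points of the set into [V + dX], so a finite
    cover of [X] by translates of these differences would make [cX] totally bounded modulo [dX]. *)
Lemma thin_thicken V W c d e : (forall x y, W x -> W y -> V (x - y)) ->
  ~ tbounded c (thicken V d) -> thin [set x | thicken W d (x *+ c - e)].
Proof.
move=> WV ntb F; apply: contrapT => nz; apply: ntb.
exists [seq f *+ c | f <- F] => z; apply: contrapT => nf.
apply: nz; exists z => f s s' fF [w Ww] [w' Ww'] zE; apply: nf.
exists (f *+ c); first exact: map_f.
exists (w - w'); have := WV _ _ Ww Ww'; congr V.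
rewrite zE mulrnBl mulrnDl mulrnBl.
zmodule.
Qed.

Lemma finite_combinations (s : seq X) (B : nat) : exists E : seq X,
  forall k : nat -> int, (forall j, (`|k j| <= B)%N) ->
    \sum_(j < size s) nth 0 s j *~ k j \in E.
Proof.
elim/last_ind: s => [|s x [E EP]].
  by exists [:: 0] => k _; rewrite big_ord0 inE.
exists [seq e + x *~ (a%:Z - B%:Z) | e <- E, a <- iota 0 (B + B).+1] => k kB.
apply/allpairsP.
exists (\sum_(j < size s) nth 0 s j *~ k j, absz (k (size s) + B%:Z)).
have kE : (absz (k (size s) + B%:Z))%:Z - B%:Z = k (size s).
  by have := kB (size s); lia.
split; [exact: EP|rewrite mem_iota; have := kB (size s) => /=; lia|].
rewrite kE size_rcons big_ord_recr /= nth_rcons ltnn eqxx; congr (_ + _).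
by apply: eq_bigr => j _; rewrite nth_rcons ltn_ord.
Qed.

(** Each term avoids finitely many thin sets fixed by the previous ones: its multiples by [c] not
    divisible by [d] stay away, modulo [dX], from the bounded combinations of earlier terms. The
    coefficients are then shown divisible from the last one down. *)
Lemma generic_sequence : exists x : nat -> X, forall d, good d ->
  exists2 V, N V & forall (k : nat -> int) (L : nat),
    (forall i, `|k i| * 2 ^ d <= 2 ^ i)%N ->
    thicken V d (\sum_(i < L) x i *~ k i) ->
    forall i, (i < L)%N -> (d %| `|k i|)%N.
Proof.
have goodV d : exists W, N W /\ (good d -> (forall x, W x -> W (- x)) /\
    exists V, (forall x y, W x -> W y -> V (x - y)) /\
      forall c, ~~ (d %| c)%N -> ~ tbounded c (thicken V d)).
  have [[V NV Vd]|ngood] := pselect (good d); last first.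
    by exists setT; split => //; exact: filterT.
  have [W [NW Wsym WV]] := nbhs0_split_sym NV.
  exists W; split=> // _; split=> //; exists V; split=> // x y Wx /Wsym.
  exact: WV.
have {goodV}[W WP] := choice goodV.
have next (s : seq X) : exists x : X, exists E : seq X,
   (forall k : nat -> int, (forall j, `|k j| <= 2 ^ size s)%N ->
      \sum_(j < size s) nth 0 s j *~ k j \in E) /\
   forall d c e, (d <= size s)%N -> good d -> (c <= 2 ^ size s)%N ->
     ~~ (d %| c)%N -> e \in E -> ~ thicken (W d) d (x *+ c - e).
  have [E EP] := finite_combinations s (2 ^ size s).
  pose r := [seq p <- [seq (d, c) | d <- iota 0 (size s).+1,
               c <- iota 0 (2 ^ size s).+1] | `[< good p.1 >] & ~~ (p.1 %| p.2)%N].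
  pose S (i : nat * nat * X) := [set x | thicken (W i.1.1) i.1.1 (x *+ i.1.2 - i.2)].
  have [|x xP] := @avoid_thin_translates X _ [seq (p, e) | p <- r, e <- E] S _ [:: 0].
    move=> [p e] /allpairsP[[p' e'] /= [p'r e'E [-> ->]]] {p e}.
    move: p'r; rewrite mem_filter => /andP[/andP[/asboolP gp np] _].
    have [_ /(_ gp)[_ [V [WV Vp]]]] := WP p'.1.
    exact: thin_thicken WV (Vp _ np).
  exists x, E; split=> // d c e ds gd cs dc eE.
  rewrite -[x]subr0; apply: (xP (d, c, e) 0); last by rewrite inE.
  have dcr : (d, c) \in r.
    rewrite mem_filter /= dc andbT; apply/andP; split; first exact/asboolP.
    have di : d \in iota 0 (size s).+1 by rewrite mem_iota.
    have ci : c \in iota 0 (2 ^ size s).+1 by rewrite mem_iota.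
    exact: (@allpairs_f _ _ _ (@pair _ _) _ _ d c di ci).
  exact: (@allpairs_f _ _ _ (@pair _ _) r E (d, c) e dcr eE).
have {next}[next nextP] := choice next.
pose hist := fix hist n := if n is m.+1 then rcons (hist m) (next (hist m)) else [::].
have size_hist n : size (hist n) = n by elim: n => //= n IHn; rewrite size_rcons IHn.
pose x n := next (hist n).
have nth_hist n j : (j < n)%N -> nth 0 (hist n) j = x j.
  elim: n => // n IHn; rewrite ltnS leq_eqVlt => /predU1P[->|jn] /=.
    by rewrite nth_rcons size_hist ltnn eqxx.
  by rewrite nth_rcons size_hist jn IHn.
exists x => d gd; exists (W d); first by have [] := WP d.
move=> k L kle; have [Wsym _] := (WP d).2 gd.
have kle' i : (`|k i| <= 2 ^ i)%N.
  by apply: leq_trans (kle i); rewrite leq_pmulr // expn_gt0.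
elim: L => // L IHL; rewrite big_ord_recr /= => thL.
have dkL : (d %| `|k L|)%N.
  apply: contrapT => /negP ndk.
  (* Step [L] of the construction only treats [d <= L]; for [L < d] the bound on [k L] would force
     it to vanish. *)
  have dL : (d <= L)%N.
    rewrite leqNgt; apply/negP => Ld; have := kle L.
    have k0 : (0 < `|k L|)%N by case: (`|k L|%N) ndk => //; rewrite dvdn0.
    have : (2 ^ L < 2 ^ d)%N by rewrite ltn_exp2l.
    by nia.
  have [E [EP avoid]] := nextP (hist L); rewrite size_hist in EP avoid.
  have sumE : \sum_(j < L) x j *~ k j =
      \sum_(j < L) nth 0 (hist L) j *~ (if (j < L)%N then k j else 0).
    by apply: eq_bigr => j _; rewrite nth_hist // ltn_ord.
  have sumN : \sum_(j < L) x j *~ - k j =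
      \sum_(j < L) nth 0 (hist L) j *~ (if (j < L)%N then - k j else 0).
    by apply: eq_bigr => j _; rewrite nth_hist // ltn_ord.
  have bnd j : (j < L -> `|k j| <= 2 ^ L)%N.
    by move=> jL; apply: leq_trans (kle' j) _; rewrite leq_exp2l // ltnW.
  have eE : \sum_(j < L) x j *~ k j \in E.
    rewrite sumE; apply: (EP (fun j => if (j < L)%N then k j else 0)) => j.
    by case: ifP => // /bnd.
  have eNE : \sum_(j < L) x j *~ - k j \in E.
    rewrite sumN; apply: (EP (fun j => if (j < L)%N then - k j else 0)) => j.
    by case: ifP => // /bnd; rewrite abszN.
  have [k0|k0] := leP 0 (k L).
    apply: (avoid d _ _ dL gd (kle' L) ndk eNE).
    rewrite pmulrn gez0_abs //; move: thL; congr thicken.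
    have -> : \sum_(j < L) x j *~ - k j = - \sum_(j < L) x j *~ k j.
      by rewrite -sumrN; apply: eq_bigr => j _; rewrite mulrNz.
    by zmodule.
  apply: (avoid d _ _ dL gd (kle' L) ndk eE).
  rewrite pmulrn ltz0_abs // mulrNz; move: thL => [w /Wsym Ww].
  by exists (- w); move: Ww; congr (W d); rewrite mulNrn; zmodule.
move=> i; rewrite ltnS leq_eqVlt => /predU1P[->//|iL].
apply: IHL iL; move: thL.
have /dvdnP[q kLE] := dkL.
(* The last term lies in [dX] and is absorbed by the thickening. *)
pose w := if 0 <= k L then - x L *+ q else x L *+ q.
move=> /(thicken_add w); rewrite -addrA; congr (thicken _ _ _).
rewrite [X in _ + X](_ : _ = 0) ?addr0 // /w; case: leP => k0.
  by rewrite -mulrnA -kLE mulNrn pmulrn gez0_abs // subrr.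
by rewrite -mulrnA -kLE pmulrn ltz0_abs // mulrNz subrr.
Qed.

End TotallyBounded.

(** * Bohr neighbourhoods *)

Section Bohr.
Variables (X : zmodType) (N : set_system X).
Hypothesis grN : group_nbhs0 N.
Implicit Types (U V W : set X) (x y : X).

Lemma nbhs0_multiples n U : N U -> exists2 V, N V &
  forall x (k : int), (`|k| <= n)%N -> V x -> U (x *~ k).
Proof.
move=> NU; have [V NV VU] : exists2 V, N V &
    forall x m, (m <= n)%N -> V x -> U (x *+ m).
  elim: n U NU => [|n IHn] U NU.
    exists setT => [|x m]; first exact: filterT.
    by rewrite leqn0 => /eqP-> _; exact: (nbhs0_mem grN NU).
  have [W [NW _ WU]] := nbhs0_split_sym grN NU; have [V NV VW] := IHn W NW.
  exists (V `&` W); first exact: filterI.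
  move=> x [_ _|m mn [Vx Wx]]; first exact: (nbhs0_mem grN NU).
  by rewrite mulrSr; apply: WU => //; exact: VW.
exists (V `&` [set x | V (- x)]); first by apply: filterI => //; exact: (nbhs0_opp grN).
move=> x k kn [Vx VNx]; have [k0|k0] := leP 0 k.
  by rewrite -(gez0_abs k0) -pmulrn; exact: VU.
rewrite -[k]opprK -(ltz0_abs k0) mulrNz -mulNrz -pmulrn; exact: VU.
Qed.

Lemma nbhs0_sums n U : N U -> exists2 V, N V &
  forall f : nat -> X, (forall i, (i < n)%N -> V (f i)) -> U (\sum_(i < n) f i).
Proof.
move=> NU; elim: n U NU => [|n IHn] U NU.
  by exists setT => [|f _]; [exact: filterT|rewrite big_ord0; exact: (nbhs0_mem grN NU)].
have [W NW WU] := nbhs0_split grN NU; have [V NV VW] := IHn W NW.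
exists (V `&` W); first exact: filterI.
move=> f VWf; rewrite big_ord_recr /=; apply: WU; last by have [] := VWf n (leqnn _).
by apply: VW => i iN; have [] := VWf i (leqW iN).
Qed.

Hypothesis tbN : forall U, N U -> exists2 n, (0 < n)%N & tbounded n U.

(* Dirichlet: pigeonhole on the multiples of the vector [y] *)
Lemma simultaneous_recurrence U (n : nat) (y : nat -> X) : N U ->
  exists2 M, (0 < M)%N & forall i, (i < n)%N -> U (y i *+ M).
Proof.
move=> NU; have [V [NV Vsym VU]] := nbhs0_split_sym grN NU.
have [k k0 [F FP]] := tbN NV.
have col t i : exists j : 'I_(size F), V (y i *+ t *+ k - F`_j).
  have [f fF Vf] := FP (y i *+ t).
  have lt_f : (index f F < size F)%N by rewrite index_mem.
  by exists (Ordinal lt_f); rewrite nth_index.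
have {col}[col colP] := choice (fun p : nat * nat => col p.1 p.2).
pose T := {ffun 'I_n -> 'I_(size F)}.
pose c (t : 'I_(#|T|.+1)) : T := [ffun i : 'I_n => col (t : nat, i : nat)].
have : ~~ injectiveb c.
  apply/negP => /injectiveP/leq_card; by rewrite card_ord ltnn.
move=> /injectivePn[t [s]]; wlog ts : t s / (t < s)%N.
  move=> th ts cts; have [lt_ts|lt_st|/val_inj e] := ltngtP t s.
  - exact: (th t s).
  - by apply: (th s t); rewrite // eq_sym.
  - by rewrite e eqxx in ts.
move=> _ cts; exists ((s - t) * k)%N; first by rewrite muln_gt0 subn_gt0 ts.
move=> i iN; have := VU _ _ (colP (s : nat, i)) (Vsym _ (colP (t : nat, i))).
have -> : col (s : nat, i) = col (t : nat, i).
  by move/ffunP: cts => /(_ (Ordinal iN)); rewrite !ffunE.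
congr U; rewrite mulrnA mulrnBr; last exact: ltnW.
by rewrite mulrnBl; zmodule.
Qed.

Lemma Zp_eq_int (p : nat) (a b c d : 'I_p.+1) (k : int) :
  a + b - c - d = inZp `|(k %% p.+1)%Z|%N ->
  exists q : int, k = a%:Z + b%:Z - c%:Z - d%:Z + p.+1%:Z * q.
Proof.
have ZD (u v : 'I_p.+1) : exists q : int, (u + v)%R%:Z = u%:Z + v%:Z + p.+1%:Z * q :> int.
  exists (- ((u + v) %/ p.+1)%N%:Z) => /=.
  by have := divn_eq (u + v) p.+1; nia.
have ZN (u : 'I_p.+1) : exists q : int, (- u)%R%:Z = - u%:Z + p.+1%:Z * q :> int.
  exists (1 - ((p.+1 - u) %/ p.+1)%N%:Z) => /=.
  by have := divn_eq (p.+1 - u) p.+1; have := ltn_ord u; nia.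
move=> /(congr1 (fun u : 'I_p.+1 => u%:Z)).
have [q1 ->] := ZD (a + b - c) (- d); have [q2 ->] := ZD (a + b) (- c).
have [q3 ->] := ZD a b; have [q4 ->] := ZN c; have [q5 ->] := ZN d.
rewrite /= modn_small; last first.
  have := ltz_pmod k (_ : 0 < p.+1%:Z); have := modz_ge0 k (_ : p.+1%:Z != 0).
  by move=> /(_ isT) ? /(_ isT); lia.
rewrite gez0_abs ?modz_ge0 // => E.
exists ((k %/ p.+1)%Z + q1 + q2 + q3 + q4 + q5).
by rewrite {1}(divz_eq k p.+1) -E; ring.
Qed.

(* [M] is a common almost period of the multiples of [g x_i], so that
   [c |-> \sum_i c_i g x_i] is almost additive on [(Z/M)^n]; a colouring of this group
   by the translates of [V] gives a dense set to which Bogolyubov's lemma applies.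
   The number of characters does not depend on [n]. *)
Lemma bohr_finite V F g (x : nat -> X) n : N V ->
    (0 < g)%N -> (forall x, exists2 f, f \in F & V (x *+ g - f)) ->
  exists z : nat -> nat -> algC, (forall l i, `|z l i| = 1) /\
    forall k : nat -> int, (forall i, (`|k i| <= n)%N) ->
      (forall l, (l < 2 * size F ^ 2)%N ->
         `|\prod_(i < n) z l i ^ (g%:Z * k i) - 1| <= 1) ->
      exists a b c d e, [/\ V a, V b, V c, V d & V e] /\
        \sum_(i < n) x i *~ (g%:Z * k i) = a + b - c - d + e.
Proof.
move=> NV g0 FP; pose y i := x i *+ g.
have [V1 NV1 V1V] := nbhs0_sums n NV.
(* [n + 4] bounds the quotients [q i] below, since [k i] is at most [n] in absolute value and the
   four residues are less than [p.+1]. *)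
have [V2 NV2 V2V1] := nbhs0_multiples (n + 4) NV1.
have [M M0 MP] := simultaneous_recurrence n y NV2.
case: M M0 MP => // p _ MP.
pose gT := 'rV['I_p.+1]_n.
pose phi (c : gT) := \sum_(i < n) y i *+ (c 0 i : nat).
have colex (c : gT) : exists j : 'I_(size F), V (phi c - F`_j).
  have [f fF Vf] := FP (\sum_(i < n) x i *+ (c 0 i : nat)).
  have lt_f : (index f F < size F)%N by rewrite index_mem.
  exists (Ordinal lt_f); rewrite nth_index //; move: Vf; congr (V (_ - _)).
  by rewrite -sumrMnl; apply: eq_bigr => i _; rewrite mulrnAC.
have {colex}[col colP] := choice colex.
pose A j : {set gT} := finset (fun c => col c == j).
have gT0 : (0 < #|gT|)%N by apply/card_gt0P; exists 0.
have [j leA] : exists j, (#|gT| <= size F * #|A j|)%N.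
  apply: contrapT => nj.
  have sumA : (\sum_(j < size F) #|A j| = #|gT|)%N.
    rewrite -sum1_card (partition_big col predT) //=; apply: eq_bigr => j _.
    by rewrite -sum1_card; apply: eq_bigl => c; rewrite inE.
  have : (\sum_(j < size F) size F * #|A j| <= \sum_(j < size F) #|gT|.-1)%N.
    apply: leq_sum => j _; rewrite -ltnS prednK //.
    by rewrite ltnNge; apply/negP => le; apply: nj; exists j.
  rewrite -big_distrr /= sumA sum_nat_const card_ord.
  have F0 : (0 < size F)%N by have [f] := FP 0; case: (F).
  by rewrite leq_pmul2l // -ltnS prednK // ltnn.
have [chi [chi1 chiM chiB]] := bogolyubov (FinRing.Theory.zmod_abelian _) leA.
pose delta (i : nat) : gT := \row_i' (if i' == i :> nat then inZp 1 else 0).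
pose w l i := chi l (delta i).
(* Roots are taken so that the constraint on [g * k] becomes one on the value of [chi] at [k]. *)
exists (fun l i => g.-root (w l i)); split.
  move=> l i; apply/eqP; rewrite -(@pexpr_eq1 _ _ g) //.
  by rewrite -normrX rootCK // chi1.
move=> k kn kP; pose c : gT := \row_i inZp `|(k i %% p.+1)%Z|%N.
have chi0 l : chi l 0 = 1.
  have := chiM l 0 0; rewrite FinRing.Theory.zmodMgE addr0 => /eqP.
  rewrite -subr_eq0 -{1}[chi l 0]mulr1 -mulrBr mulf_eq0 -normr_eq0 chi1 oner_eq0.
  by rewrite subr_eq0 => /eqP.
have chiX l u m : chi l (u *+ m) = chi l u ^+ m.
  elim: m => [|m IHm]; first by rewrite mulr0n chi0.
  by rewrite mulrS exprS -IHm; exact: (chiM l u (u *+ m)).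
have chi_sum l (f : 'I_n -> gT) : chi l (\sum_i f i) = \prod_i chi l (f i).
  by apply: (big_morph (chi l) (chiM l) (chi0 l)).
have wM l i : w l i ^+ p.+1 = 1.
  rewrite -chiX (_ : _ *+ _ = 0) ?chi0 //; apply/rowP => i'.
  rewrite mulmxnE Zp_mulrn [RHS]mxE; apply: val_inj => /=; exact: modnMl.
have cE : c = \sum_(i < n) delta i *+ `|(k i %% p.+1)%Z|%N.
  apply/rowP => i; rewrite summxE (bigD1 i) //= big1 => [|i' /negbTE i'i].
    rewrite addr0 mulmxnE !mxE eqxx Zp_mulrn; apply: val_inj => /=.
    by rewrite modnMml mul1n.
  by rewrite mulmxnE mxE (inj_eq val_inj) eq_sym i'i mul0rn.
have chic l : chi l c = \prod_(i < n) w l i ^ k i.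
  rewrite cE chi_sum; apply: eq_bigr => i _; rewrite chiX -/(w l i).
  have wu : w l i \is a GRing.unit by rewrite unitfE -normr_eq0 chi1 oner_eq0.
  have wMz : w l i ^ p.+1%:Z = 1 by rewrite -exprnP wM.
  rewrite [in RHS](divz_eq (k i) p.+1) exprzDr // [(_ * p.+1%:Z)%R]mulrC.
  by rewrite -exprz_exp wMz exp1rz mul1r -{2}[(_ %% _)%Z]gez0_abs ?modz_ge0.
have [l lR|a [b [a' [b' [aA bA a'A b'A cE']]]]] := chiB c.
  rewrite chic; have := kP l lR; congr (`| _ - 1| <= 1).
  by apply: eq_bigr => i _; rewrite -exprz_exp -exprnP rootCK.
have {}cE' : c = a + b - a' - b' by [].
(* The identity modulo [p.+1] lifts to the integers up to multiples of [p.+1]; these contribute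
   multiples of the [y i *+ p.+1], which are small. *)
have qex i : exists q : int, forall i' : 'I_n, i' = i :> nat ->
    k i = (a 0 i')%:Z + (b 0 i')%:Z - (a' 0 i')%:Z - (b' 0 i')%:Z + p.+1%:Z * q.
  have [iN|nI] := ltnP i n; last first.
    by exists 0 => i' ii'; move: nI; rewrite -ii' leqNgt ltn_ord.
  have [|q qE] := @Zp_eq_int p (a 0 (Ordinal iN)) (b 0 (Ordinal iN))
      (a' 0 (Ordinal iN)) (b' 0 (Ordinal iN)) (k i).
    by move/rowP: cE' => /(_ (Ordinal iN)); rewrite !mxE /= => ->.
  exists q => i' ii'; rewrite qE.
  by rewrite (_ : i' = Ordinal iN) //; apply: val_inj.
have {qex}[q qE] := choice qex.
have inA c' : c' \in A j -> V (phi c' - F`_j).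
  by rewrite inE => /eqP <-; exact: colP.
exists (phi a - F`_j), (phi b - F`_j), (phi a' - F`_j), (phi b' - F`_j).
exists (\sum_(i < n) y i *+ p.+1 *~ q i); split.
  split; [exact: inA|exact: inA|exact: inA|exact: inA|].
  apply: (V1V (fun i => y i *+ p.+1 *~ q i)) => i iN.
  apply: V2V1; last exact: MP.
  have := qE i (Ordinal iN) erefl; have := kn i.
  have := ltn_ord (a 0 (Ordinal iN)); have := ltn_ord (b 0 (Ordinal iN)).
  have := ltn_ord (a' 0 (Ordinal iN)); have := ltn_ord (b' 0 (Ordinal iN)).
  set u := nat_of_ord _; set v := nat_of_ord _.
  set u' := nat_of_ord _; set v' := nat_of_ord _.
  move=> up vp u'p v'p kin kE; rewrite leqNgt; apply/negP => nq.
  by nia.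
transitivity (phi a + phi b - phi a' - phi b' + \sum_(i < n) y i *+ p.+1 *~ q i).
  rewrite /phi -big_split -sumrB -sumrB -big_split /=.
  apply: eq_bigr => i _; rewrite mulrzA -pmulrn -/(y i) (qE i i erefl).
  by rewrite !mulrzDr !mulrNz mulrzA -!pmulrn.
by zmodule.
Qed.
End Bohr.

(** * The limit of a generic sequence *)

Lemma ultra_colour (T : finType) (I : Type) (UU : set_system I) (c : I -> T) :
  UltraFilter UU -> exists t, UU [set i | c i = t].
Proof.
move=> ultraUU; apply: contrapT => nt.
have : UU [set i | forall t, c i <> t].
  apply: filter_forall => t.
  have [ct|//] := in_ultra_setVsetC [set i | c i = t] ultraUU.
  by exfalso; apply: nt; exists t.
by move=> /filter_ex[i /(_ (c i))].
Qed.

(** The colour records the floors of [K] times the real and imaginary parts. With [K = 2 ^ e.+1],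
    points of one colour differ in each part by less than half of the target. *)
Lemma arcs_of_circle (e : nat) : exists (T : finType) (c : algC -> T),
  forall a b, `|a| = 1 -> `|b| = 1 -> c a = c b -> `|a - b| < 2^-1 ^+ e.
Proof.
have [K KE] : exists K, K = (2 ^ e.+1)%N by exists (2 ^ e.+1)%N.
have K0 : 0 < K%:R :> algC by rewrite KE ltr0n expn_gt0.
pose f (x : algC) : 'I_(K + K).+1 := inord (absz (Num.floor (K%:R * x) + K%:Z)).
have fP (x y : algC) : x \is Num.real -> y \is Num.real -> `|x| <= 1 -> `|y| <= 1 ->
    f x = f y -> `|x - y| < K%:R^-1.
  move=> xR yR x1 y1.
  have KR (z : algC) : z \is Num.real -> K%:R * z \is Num.real.
    by move=> zR; rewrite realM // ger0_real // ler0n.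
  have bnd (z : algC) : z \is Num.real -> `|z| <= 1 -> (- K%:Z <= Num.floor (K%:R * z) <= K%:Z).
    move=> zR; rewrite real_ler_norml // => /andP[z1 z2]; apply/andP; split.
      have : K%:R * (-1) <= K%:R * z by rewrite ler_pM2l; [exact: z1|exact: K0].
      by rewrite real_floor_ge_int ?KR // mulrN1 mulrNz -pmulrn.
    rewrite -ltzD1 real_floor_lt_int ?KR //.
    apply: (@le_lt_trans _ _ K%:R); first by rewrite ger_pMr; [exact: z2|exact: K0].
    by rewrite intrD ltrDl ltr01.
  move=> /(congr1 (fun i : 'I__ => i : nat)); rewrite /f !inordK; last 2 first.
  - by have := bnd y yR y1; lia.
  - by have := bnd x xR x1; lia.
  move=> eqf; have {}eqf : Num.floor (K%:R * x) = Num.floor (K%:R * y).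
    by have := bnd y yR y1; have := bnd x xR x1; lia.
  have := real_floor_itv (KR x xR); have := real_floor_itv (KR y yR).
  rewrite eqf intrD; set m := (Num.floor _)%:~R => /andP[my yM] /andP[mx xM].
  rewrite -(ltr_pM2l K0) mulfV ?gt_eqF // -[X in X * `|_|]ger0_norm ?ler0n //.
  rewrite -normrM mulrBr real_ltr_norml ?realB ?KR //.
  apply/andP; split.
    by rewrite ltrBrDr addrC ltrBlDr (lt_le_trans yM) // lerD2r.
  by rewrite ltrBlDr addrC (lt_le_trans xM) // lerD2r.
exists ('I_(K + K).+1 * 'I_(K + K).+1)%type, (fun a => (f ('Re a), f ('Im a))).
move=> a b a1 b1 [Reab Imab].
have Re1 z : `|z| = 1 -> `|'Re z| <= 1 :> algC.
  by move=> <-; have [] := leif_normC_Re_Creal z.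
have Im1 z : `|z| = 1 -> `|'Im z| <= 1 :> algC.
  move=> z1; rewrite -[1](normrN1 algC) -z1.
  have -> : 'Im z = 'Re (- 'i * z) by rewrite mulNr raddfN /= ReMil opprK.
  have [+ _] := leif_normC_Re_Creal (- 'i * z).
  by rewrite normrM normrN normCi mul1r z1 normrN1.
have Rlt := fP _ _ (Creal_Re a) (Creal_Re b) (Re1 _ a1) (Re1 _ b1) Reab.
have Ilt := fP _ _ (Creal_Im a) (Creal_Im b) (Im1 _ a1) (Im1 _ b1) Imab.
rewrite [a]Crect [b in _ - b]Crect.
have -> : 'Re a + 'i * 'Im a - ('Re b + 'i * 'Im b) =
    ('Re a - 'Re b) + 'i * ('Im a - 'Im b) by ring.
apply: (le_lt_trans (ler_normD _ _)); rewrite normrM normCi mul1r.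
have -> : 2^-1 ^+ e = K%:R^-1 + K%:R^-1 :> algC.
  rewrite KE expnS natrM natrX exprVn invfM -mulrDl (_ : 2^-1 + 2^-1 = 1) ?mul1r //.
  by field.
exact: ltrD.
Qed.

Lemma big_ord_support (R : Type) (idx : R) (op : Monoid.law idx) (F : nat -> R) (L m : nat) :
  (L <= m)%N -> (forall i, (L <= i)%N -> F i = idx) ->
  \big[op/idx]_(i < m) F i = \big[op/idx]_(i < L) F i.
Proof.
move=> Lm F0; rewrite -(subnKC Lm); elim: (m - L)%N => [|d IHd].
  by rewrite addn0.
by rewrite addnS big_ord_recr /= F0 ?leq_addr // Monoid.mulm1.
Qed.

Lemma sum_supportB (V : zmodType) (f g : nat -> V) (L L' : nat) :
  (forall i, (L <= i)%N -> f i = 0) -> (forall i, (L' <= i)%N -> g i = 0) ->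
  \sum_(i < maxn L L') (f i - g i) = \sum_(i < L) f i - \sum_(i < L') g i.
Proof.
move=> fL gL'; rewrite sumrB (big_ord_support +%R (leq_maxl L L') fL).
by rewrite (big_ord_support +%R (leq_maxr L L') gL').
Qed.

Lemma sum_supportD (V : zmodType) (f g : nat -> V) (L L' : nat) :
  (forall i, (L <= i)%N -> f i = 0) -> (forall i, (L' <= i)%N -> g i = 0) ->
  \sum_(i < maxn L L') (f i + g i) = \sum_(i < L) f i + \sum_(i < L') g i.
Proof.
move=> fL gL'; rewrite big_split /= (big_ord_support +%R (leq_maxl L L') fL).
by rewrite (big_ord_support +%R (leq_maxr L L') gL').
Qed.

(** The intersection of the sets [B - B]: the points that translates of a common [B] do not separate
    from 0, by which the group is divided to become Hausdorff. *)
Definition base_kernel (G : zmodType) (BB : set_system G) : set G :=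
  [set u | forall B, BB B -> exists v w, [/\ B v, B w & u = v - w]].

Record semigroup_base (G : zmodType) (BB : set_system G) : Prop := SemigroupBase {
  base_nonempty : exists B, BB B;
  base_inter : forall A B, BB A -> BB B -> exists2 C, BB C & C `<=` A `&` B;
  base_zero : forall B, BB B -> B 0;
  base_add : forall B, BB B ->
    exists2 C, BB C & forall u v, C u -> C v -> B (u + v) }.

(* In the semigroup topology with base [BB] at [0], the point [(0, 1)] is a limit
   of points of [X]; modulo the kernel the topology induced on [X] is given by
   [N]. *)
Record limit_base (X : zmodType) (N : set_system X)
    (BB : set_system (X * int)%type) : Prop := LimitBase {
  limit_base_semigroup : semigroup_base BB;
  base_induced : forall U, N U -> exists2 B, BB B &
    forall x v, base_kernel BB v -> B ((x, 0) + v) -> U x;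
  base_nbhs : forall B, BB B -> N [set x | B (x, 0)];
  base_limit : forall B, BB B -> exists x, B (x, -1);
  base_new : forall x, ~ base_kernel BB (x, 1) }.

(** * The limit base attached to a generic sequence and a free ultrafilter *)

Section Base.
Variables (X : zmodType) (N : set_system X).
Let G := (X * int)%type.

Hypothesis grN : group_nbhs0 N.
Hypothesis sepN : forall x, (forall U, N U -> U x) -> x = 0.
Hypothesis not_tbN : forall n, (0 < n)%N -> exists2 U, N U & ~ tbounded n U.

Variables (UU : set_system nat) (x : nat -> X).
Hypothesis ultraUU : UltraFilter UU.
Hypothesis freeUU : forall n, UU [set i | (n <= i)%N].
Hypothesis genericx : forall d, good N d ->
  exists2 V, N V & forall (k : nat -> int) (L : nat),
    (forall i, `|k i| * 2 ^ d <= 2 ^ i)%N ->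
    thicken V d (\sum_(i < L) x i *~ k i) ->
    forall i, (i < L)%N -> (d %| `|k i|)%N.

Let family := (nat * (nat -> nat -> nat -> algC))%type.

Definition unitary (z : family) : Prop := forall l M i, `|z.2 l M i| = 1.

Lemma unitary1 : unitary (0%N, fun _ _ _ => 1).
Proof. by move=> l M i; rewrite normr1. Qed.

(* Each [z.2 l] stands for the ultraproduct over [M] of the characters
   [k |-> \prod_i z.2 l M i ^ k i]; dividing by [z.2 l M j] recentres it at the limit of
   its values on the generators along the ultrafilter [UU]. *)
Definition char_close (z : family) (e : nat) (k : nat -> nat) (L : nat) : Prop :=
  UU [set j | UU [set M | forall l, (l < z.1)%N ->
    `|\prod_(i < L) (z.2 l M i / z.2 l M j) ^+ k i - 1| < 2^-1 ^+ e]].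

(** With [y] the point [(0, 1)], these are the [u + \sum_i k_i (x_i - y)] with [u] in [U]. The first
    bound forces [k i = 0] for [i < n]. *)
Definition limit_nbhs (U : set X) (n : nat) (z : family) (e : nat) : set G :=
  [set p | exists (k : nat -> nat) (L : nat),
    [/\ forall i, (k i * 2 ^ n <= 2 ^ i)%N, forall i, (L <= i)%N -> k i = 0%N,
        U (p.1 - \sum_(i < L) x i *+ k i), p.2 = - (\sum_(i < L) k i)%N%:Z &
        char_close z e k L]].

Definition limit_system : set_system G :=
  [set B | exists U n z e, [/\ N U, unitary z & B = limit_nbhs U n z e]].

Lemma prod_expr_support (f : nat -> algC) (k : nat -> nat) (L m : nat) :
  (L <= m)%N -> (forall i, (L <= i)%N -> k i = 0%N) ->
  \prod_(i < m) f i ^+ k i = \prod_(i < L) f i ^+ k i.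
Proof.
move=> Lm k0; apply: (big_ord_support *%R (F := fun i => f i ^+ k i)) => // i Li.
by rewrite k0.
Qed.

Lemma norm_mul_sub1 (a b : algC) : `|a| = 1 -> `|a * b - 1| <= `|a - 1| + `|b - 1|.
Proof.
move=> a1; rewrite (_ : a * b - 1 = (a - 1) + a * (b - 1)); last by ring.
by rewrite (le_trans (ler_normD _ _)) // normrM a1 mul1r.
Qed.

Lemma norm_prod_char z l M j (k : nat -> nat) L : unitary z ->
  `|\prod_(i < L) (z.2 l M i / z.2 l M j) ^+ k i| = 1.
Proof.
move=> uz; rewrite normr_prod big1 // => i _.
by rewrite normrX normrM normfV !uz invr1 mulr1 expr1n.
Qed.

Lemma limit_nbhs_zero U n z e : N U -> limit_nbhs U n z e 0.
Proof.
move=> NU; exists (fun=> 0%N), 0%N; split=> //.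
- by rewrite big_ord0 subr0; exact: (nbhs0_mem grN).
- by rewrite big_ord0 oppr0.
apply: filterE => j; apply: filterE => M l _.
by rewrite big_ord0 subrr normr0 exprn_gt0 // invr_gt0.
Qed.

(** Passing to [n.+1] and [e.+1] halves the bounds on the coefficients and on the distances of the
    products to 1, which pays for one addition. *)
Lemma limit_nbhs_add U V n z e : unitary z ->
  (forall a b, V a -> V b -> U (a + b)) ->
  forall u v, limit_nbhs V n.+1 z e.+1 u -> limit_nbhs V n.+1 z e.+1 v ->
    limit_nbhs U n z e (u + v).
Proof.
move=> uz VU u v [k [L [kn kL Vu u2 kz]]] [k' [L' [k'n k'L Vv v2 k'z]]].
exists (fun i => k i + k' i)%N, (maxn L L'); split.
- by move=> i; have := kn i; have := k'n i; rewrite !expnS; nia.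
- by move=> i; rewrite geq_max => /andP[/kL-> /k'L->].
- have := VU _ _ Vu Vv; congr U.
  rewrite (eq_bigr (fun i : 'I_(maxn L L') => x i *+ k i + x i *+ k' i)); last first.
    by move=> i _; rewrite mulrnDr.
  rewrite (sum_supportD (f := fun i => x i *+ k i) (g := fun i => x i *+ k' i)).
  - by rewrite (_ : (u + v).1 = u.1 + v.1) //; zmodule.
  - by move=> i /kL ->.
  - by move=> i /k'L ->.
- rewrite /= u2 v2 big_split /= PoszD opprD; congr (- _%:Z + - _%:Z).
    by rewrite (big_ord_support addn (leq_maxl L L') kL).
  by rewrite (big_ord_support addn (leq_maxr L L') k'L).
near=> j.
have kj : UU [set M | forall l, (l < z.1)%N ->
    `|\prod_(i < L) (z.2 l M i / z.2 l M j) ^+ k i - 1| < 2^-1 ^+ e.+1].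
  by near: j.
have k'j : UU [set M | forall l, (l < z.1)%N ->
    `|\prod_(i < L') (z.2 l M i / z.2 l M j) ^+ k' i - 1| < 2^-1 ^+ e.+1].
  by near: j.
apply: filterS2 kj k'j => M kM k'M l lz.
rewrite (eq_bigr (fun i : 'I__ => (z.2 l M i / z.2 l M j) ^+ k i *
    (z.2 l M i / z.2 l M j) ^+ k' i)); last by move=> i _; rewrite exprD.
rewrite big_split /=.
rewrite (prod_expr_support (fun i => z.2 l M i / z.2 l M j) (leq_maxl L L') kL).
rewrite (prod_expr_support (fun i => z.2 l M i / z.2 l M j) (leq_maxr L L') k'L).
apply: le_lt_trans (norm_mul_sub1 _ (norm_prod_char _ _ _ _ _ uz)) _.
have -> : 2^-1 ^+ e = 2^-1 ^+ e.+1 + 2^-1 ^+ e.+1 :> algC.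
  by rewrite exprS; field.
by apply: ltrD; [exact: kM|exact: k'M].
Unshelve. all: by end_near.
Qed.

Lemma limit_nbhs_inter U U' n n' z z' e e' : unitary z -> unitary z' ->
  exists2 z'' : family, unitary z'' &
    limit_nbhs (U `&` U') (maxn n n') z'' (maxn e e') `<=`
    limit_nbhs U n z e `&` limit_nbhs U' n' z' e'.
Proof.
move=> uz uz'.
pose z'' : family := ((z.1 + z'.1)%N,
  fun l => if (l < z.1)%N then z.2 l else z'.2 (l - z.1)%N).
exists z''; first by move=> l M i; rewrite /z'' /=; case: ifP.
have pow (a b : nat) : (a <= b)%N -> 2^-1 ^+ b <= 2^-1 ^+ a :> algC.
  by move=> ab; apply: ler_wiXn2l; rewrite ?invr_ge0 ?invf_le1 ?ler0n ?ler1n.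
move=> u [k [L [kn kL [Uu U'u] u2 kz]]]; split; exists k, L; split=> //.
- move=> i; apply: leq_trans (kn i).
  by rewrite leq_mul2l leq_exp2l // leq_maxl orbT.
- near=> j; have : UU [set M | forall l, (l < z''.1)%N ->
    `|\prod_(i < L) (z''.2 l M i / z''.2 l M j) ^+ k i - 1| < 2^-1 ^+ (maxn e e')].
    by near: j.
  apply: filterS => M Ml l lz; have /= := Ml l; rewrite lz => /(_ (ltn_addr _ lz)).
  by move=> /lt_le_trans; apply; apply: pow; exact: leq_maxl.
- move=> i; apply: leq_trans (kn i).
  by rewrite leq_mul2l leq_exp2l // leq_maxr orbT.
- near=> j; have : UU [set M | forall l, (l < z''.1)%N ->
    `|\prod_(i < L) (z''.2 l M i / z''.2 l M j) ^+ k i - 1| < 2^-1 ^+ (maxn e e')].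
    by near: j.
  apply: filterS => M Ml l lz; have /= := Ml (z.1 + l)%N.
  rewrite ltn_add2l [(_ + l < _)%N]ltnNge leq_addr /= addKn => /(_ lz).
  by move=> /lt_le_trans; apply; apply: pow; exact: leq_maxr.
Unshelve. all: by end_near.
Qed.

(** The point is [x i - y] for some [i >= n] at which the characters nearly take their values at
    most [j]. Colouring the circle by small arcs, the ultrafilter selects such an [i]. *)
Lemma limit_nbhs_limit U n z e : N U -> unitary z ->
  exists a, limit_nbhs U n z e (a, -1).
Proof.
move=> NU uz; have [T [c cP]] := arcs_of_circle e.
have colour i : exists t : {ffun 'I_z.1 -> T},
    UU [set M | [ffun l : 'I_z.1 => c (z.2 l M i)] = t].
  exact: (@ultra_colour {ffun 'I_z.1 -> T} _ UU
    (fun M => [ffun l : 'I_z.1 => c (z.2 l M i)]) ultraUU).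
have [col colP] := choice colour.
have [t tP] := @ultra_colour _ _ UU col ultraUU.
have /filter_ex[i [coli ni]] : UU [set i | col i = t /\ (n <= i)%N].
  by apply: filterI; [exact: tP|exact: freeUU].
exists (x i), (fun j => (j == i) : nat), i.+1; split.
- by move=> j; case: eqP => [->|_]; rewrite ?mul1n ?mul0n // leq_exp2l.
- by move=> j; case: eqP => // ->; rewrite ltnn.
- rewrite big_ord_recr /= eqxx mulr1n big1 ?add0r ?subrr; first exact: (nbhs0_mem grN).
  by move=> j _; rewrite (ltn_eqF (ltn_ord j)) mulr0n.
- rewrite big_ord_recr /= eqxx big1 ?add0n // => j _.
  by rewrite (ltn_eqF (ltn_ord j)).
near=> j; have colj : col j = t by near: j.
have := colP j; rewrite colj; have := colP i; rewrite coli.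
apply: filterS2 => M Mi Mj l lz; rewrite big_ord_recr /= eqxx expr1 big1; last first.
  by move=> j' _; rewrite (ltn_eqF (ltn_ord j')).
rewrite mul1r.
have zj0 : z.2 l M j != 0 by rewrite -normr_eq0 uz oner_eq0.
have -> : z.2 l M i / z.2 l M j - 1 = (z.2 l M i - z.2 l M j) / z.2 l M j.
  by rewrite mulrBl mulfV.
rewrite normrM normfV uz invr1 mulr1.
apply: cP; rewrite ?uz //.
move: Mi Mj => /ffunP/(_ (Ordinal lz)); rewrite ffunE /= => -> /ffunP/(_ (Ordinal lz)).
by rewrite ffunE.
Unshelve. all: by end_near.
Qed.

Lemma base_kernel_repr u U n z : base_kernel limit_system u -> N U -> unitary z ->
  exists (k : nat -> int) (L : nat),
    [/\ forall i, (`|k i| * 2 ^ n <= 2 ^ i)%N, forall i, (L <= i)%N -> k i = 0,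
        U (u.1 - \sum_(i < L) x i *~ k i), u.2 = - \sum_(i < L) k i &
        u.2 = 0 -> UU [set M | forall l, (l < z.1)%N ->
          `|\prod_(i < L) z.2 l M i ^ k i - 1| <= 1]].
Proof.
move=> keru NU uz; have [V [NV Vsym VU]] := nbhs0_split_sym grN NU.
(* Taking [e = 1] puts both products within 1/2 of 1, hence their quotient within 1, the tolerance
   in [bohr_finite]. *)
have [|v [w []]] := keru (limit_nbhs V n z 1); first by exists V, n, z, 1%N.
move=> [k [L [kn kL Vu v2 kz]]] [k' [L' [k'n k'L Vv w2 k'z]]] ->.
pose K i : int := (k i)%:Z - (k' i)%:Z.
pose m := maxn L L'.
have sumK : \sum_(i < m) K i = (\sum_(i < L) k i)%N%:Z - (\sum_(i < L') k' i)%N%:Z.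
  rewrite sumrB -!(big_morph Posz PoszD erefl).
  rewrite (big_ord_support addn (leq_maxl L L') kL).
  by rewrite (big_ord_support addn (leq_maxr L L') k'L).
exists K, m; split.
- by move=> i; have := kn i; have := k'n i; rewrite /K; nia.
- by move=> i; rewrite geq_max => /andP[/kL kL0 /k'L k'L0]; rewrite /K kL0 k'L0.
- have := VU _ _ Vu (Vsym _ Vv); congr U.
  rewrite (eq_bigr (fun i : 'I_m => x i *+ k i - x i *+ k' i)); last first.
    by move=> i _; rewrite /K mulrzDr mulrNz -!pmulrn.
  rewrite (sum_supportB (f := fun i => x i *+ k i) (g := fun i => x i *+ k' i)).
  - by rewrite (_ : (v - w).1 = v.1 - w.1) //; zmodule.
  - by move=> i /kL ->.
  - by move=> i /k'L ->.
- by rewrite /= v2 w2 sumK opprB opprK addrC.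
rewrite /= v2 w2 => sum0.
have {}sum0 : \sum_(i < m) K i = 0 by rewrite sumK; move: sum0; lia.
have [j [kj k'j]] := filter_ex (@filterI _ UU _ _ _ kz k'z).
apply: filterS2 kj k'j => M kM k'M l lz.
have zU i : z.2 l M i \is a GRing.unit by rewrite unitfE -normr_eq0 uz oner_eq0.
(* As the [K i] add up to 0, the recentring factors cancel. *)
set y := z.2 l M; have prodK : \prod_(i < m) y i ^ K i = \prod_(i < m) (y i / y j) ^ K i.
  rewrite [RHS](eq_bigr (fun i : 'I_m => y i ^ K i * y j ^ - K i)); last first.
    by move=> i _; rewrite exprzMl ?unitrV ?exprz_inv.
  rewrite big_split /= [X in _ * X](_ : _ = y j ^ (- \sum_(i < m) K i)).
    by rewrite sum0 oppr0 mulr1.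
  rewrite -sumrN; apply/esym.
  by apply: (big_morph (fun k => y j ^ k)) => // a b; rewrite exprzDr.
rewrite prodK.
have -> : \prod_(i < m) (y i / y j) ^ K i =
    \prod_(i < L) (y i / y j) ^+ k i / \prod_(i < L') (y i / y j) ^+ k' i.
  rewrite -(prod_expr_support (fun i => y i / y j) (leq_maxl L L') kL).
  rewrite -(prod_expr_support (fun i => y i / y j) (leq_maxr L L') k'L).
  rewrite -prodf_div; apply: eq_bigr => i _.
  by rewrite exprzDr ?unitrM ?unitrV ?zU // -exprnN.
have := norm_prod_char l M j k' L' uz; have := kM l lz; have := k'M l lz.
set a := \prod_(i < L) _; set b := \prod_(i < L') _; rewrite !expr1.
rewrite -/y -/a -/b => b1 a1 nb.
have b0 : b != 0 by rewrite -normr_eq0 nb oner_eq0.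
have -> : a / b - 1 = (a - b) / b by rewrite mulrBl mulfV.
rewrite normrM normfV nb invr1 mulr1 (_ : a - b = (a - 1) - (b - 1)); last by ring.
apply: le_trans (ler_normB _ _) _; apply: ltW.
rewrite [ltRHS](_ : 1 = 2^-1 + 2^-1); last by field.
exact: ltrD.
Qed.

(* Two representations of [u] with disjoint supports are compared: their difference
   is a small combination, whence the divisibility of all its coefficients. *)
Lemma base_kernel_divides u d : base_kernel limit_system u -> good N d ->
  exists U n, N U /\ forall (k : nat -> int) L,
    (forall i, `|k i| * 2 ^ n <= 2 ^ i)%N -> (forall i, (L <= i)%N -> k i = 0) ->
    U (u.1 - \sum_(i < L) x i *~ k i) -> forall i, (d %| `|k i|)%N.
Proof.
move=> keru gd; have [V NV Vd] := genericx gd.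
have [U [NU Usym UV]] := nbhs0_split_sym grN NV.
exists U, d; split=> // k L kd kL Uk i.
have [iL|Li] := ltnP i L; last by rewrite kL // dvdn0.
(* At level [maxn d L] the coefficients [k'] vanish below [L], where those of [k] live, and still
   satisfy the bound for [d]. *)
have [k' [L' [k'n k'L Uk' _ _]]] := base_kernel_repr (maxn d L) keru NU unitary1.
have k'0 j : (j < L)%N -> k' j = 0.
  move=> jL; have := k'n j.
  have : (2 ^ j < 2 ^ maxn d L)%N by rewrite ltn_exp2l // leq_max jL orbT.
  have [//|k'j] := eqVneq (k' j) 0.
  have : (0 < `|k' j|)%N by rewrite absz_gt0.
  nia.
pose m := maxn L L'; pose K j := k j - k' j.
have : (d %| `|K i|)%N.
  apply: (Vd K m) => [j||]; last by rewrite leq_max iL.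
    rewrite /K; have [jL|Lj] := ltnP j L; first by rewrite k'0 // subr0.
    rewrite kL // sub0r abszN; apply: leq_trans (k'n j).
    by rewrite leq_mul2l leq_exp2l ?leq_maxl ?orbT.
  apply: thicken_base; have := UV _ _ Uk' (Usym _ Uk); congr V.
  rewrite (eq_bigr (fun i : 'I_m => x i *~ k i - x i *~ k' i)); last first.
    by move=> j _; rewrite /K mulrzDr mulrNz.
  rewrite (sum_supportB (f := fun i => x i *~ k i) (g := fun i => x i *~ k' i)).
  - by zmodule.
  - by move=> j /kL ->.
  - by move=> j /k'L ->.
by rewrite /K k'0 // subr0.
Qed.

Lemma good_zero_or_tbounded :
  good N 0 \/ forall U, N U -> exists2 n, (0 < n)%N & tbounded n U.
Proof.
have [?|ngood] := pselect (good N 0); [by left|right=> U NU].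
apply: contrapT => nU; apply: ngood; exists U => // c.
rewrite dvd0n -lt0n => c0 tbc; apply: nU; exists c => //.
by apply: sub_tbounded tbc => y [w]; rewrite mulr0n subr0.
Qed.

Lemma tbounded_mul (U : set X) g q : tbounded g U -> tbounded (g * q) U.
Proof.
move=> [F FP]; exists F => y; have [f fF Uf] := FP (y *+ q).
by exists f => //; rewrite mulnC mulrnA.
Qed.

Lemma dvdz_sum (g : nat) (k : nat -> int) L :
  (forall i, (g %| `|k i|)%N) -> (g %| `|(\sum_(i < L) k i)%R|)%N.
Proof.
move=> gk; suff: (g%:Z %| \sum_(i < L) k i)%Z by [].
by apply: rpred_sum => i _; exact: gk.
Qed.

(** Every good [g] divides the coefficients, hence their total [- u.2]. If [u.2] is nonzero, some
    good [g] does not divide it: 0, or a [g] with [gX] totally bounded for a neighbourhood for which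
    the multiples by [u.2] are not. *)
Lemma base_kernel_int u : base_kernel limit_system u -> u.2 = 0.
Proof.
move=> keru; apply: contrapT => u2; have u2' : (0 < `|u.2|)%N by rewrite absz_gt0; apply/eqP.
have [g gd ng] : exists2 g, good N g & ~~ (g %| `|u.2|)%N.
  have [g0|tbN] := good_zero_or_tbounded.
    by exists 0%N => //; rewrite dvd0n absz_eq0; apply/eqP.
  have [U NU ntbU] := not_tbN u2'.
  have [g [g0 gd tbg]] := good_exists grN tbN NU.
  exists g => //; apply/negP => /dvdnP[q qE]; apply: ntbU.
  by rewrite qE mulnC; exact: tbounded_mul.
have [U [n [NU Un]]] := base_kernel_divides keru gd.
have [k [L [kn kL Uk u2E _]]] := base_kernel_repr n keru NU unitary1.
by move: ng; rewrite u2E abszN dvdz_sum //; exact: Un kn kL Uk.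
Qed.

(** If 0 is good, all coefficients vanish and [u.1] is arbitrarily small. Otherwise a good [g]
    divides them, with [gX] totally bounded for a small [V], and the character constraints make the
    combination itself small. *)
Lemma base_kernel_trivial u : base_kernel limit_system u -> u = 0.
Proof.
move=> keru; have u2 := base_kernel_int keru.
suff u1 : u.1 = 0 by case: u u1 u2 {keru} => /= a b -> ->.
apply: sepN => U NU.
have [g0|tbN] := good_zero_or_tbounded.
  have [V [n [NV Vn]]] := base_kernel_divides keru g0.
  have [k [L [kn kL [Uk Vk] _ _]]] :=
    base_kernel_repr n keru (filterI NU NV) unitary1.
  have k0 i : k i = 0 by have := Vn k L kn kL Vk i; rewrite dvd0n absz_eq0 => /eqP.
  by move: Uk; rewrite big1 ?subr0 // => i _; rewrite k0 mulr0z.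
have [U1 [NU1 U1sym U1U]] := nbhs0_split_sym grN NU.
have [U2 [NU2 U2sym U2U1]] := nbhs0_split_sym grN NU1.
have [V [NV Vsym VU2]] := nbhs0_split_sym grN NU2.
have V0 := nbhs0_mem grN NV.
have [g [g0 gd [F FP]]] := good_exists grN tbN NV.
(* One Bogolyubov family for each [M]; the number of characters does not depend on [M], so together
   they form a [family]. *)
have [z zP] := choice (fun M => bohr_finite grN tbN x M NV g0 FP).
pose zz : family := ((2 * size F ^ 2)%N, fun l M i => z M l i).
have [W [n [NW Wn]]] := base_kernel_divides keru gd.
have [||k [L [kn kL [Vk Wk] _]]] := base_kernel_repr (U := V `&` W) n keru _ (z := zz).
- exact: filterI.
- by move=> l M i; exact: (zP M).1.
move=> /(_ u2) zk.
have gk := Wn k L kn kL Wk.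
pose h i : int := (k i %/ g%:Z)%Z.
have kh i : k i = g%:Z * h i by rewrite mulrC /h divzK //; exact: gk.
(* [M] is taken beyond the support bound [L] and all the [|h i|], so that [bohr_finite] applies with
   [n = M]. *)
have [M [[Mz LM] hM]] := filter_ex (@filterI _ UU _ _ _
  (@filterI _ UU _ _ _ zk (freeUU L)) (freeUU (\sum_(i < L) `|h i|)%N)).
have [_ /(_ h)[||a [b [c [d [e [[Va Vb Vc Vd Ve] sumE]]]]]]] := zP M.
- move=> i; have [iL|Li] := ltnP i L; last by rewrite /h kL // div0z.
  apply: leq_trans hM; rewrite (bigD1 (Ordinal iL)) //=; exact: leq_addr.
- move=> l lF; have := Mz l lF; congr (`|_ - 1| <= 1).
  rewrite -(big_ord_support *%R (F := fun i => zz.2 l M i ^ k i) LM); last first.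
    by move=> i Li; rewrite kL.
  by apply: eq_bigr => i _; rewrite kh.
move: sumE; rewrite (eq_bigr (fun i : 'I_M => x i *~ k i)); last by move=> i _; rewrite -kh.
rewrite (big_ord_support +%R (F := fun i => x i *~ k i) LM); last by move=> i Li; rewrite kL.
move=> sumE; move: Vk; rewrite sumE => Vk.
(* Six elements of [V], up to sign, are padded to eight for three halvings. *)
have -> : u.1 = ((u.1 - (a + b - c - d + e) + a) + (b - c)) + ((- d + e) + (0 + 0)).
  by zmodule.
apply: U1U; apply: U2U1; apply: VU2 => //; exact: Vsym.
Qed.

Lemma limit_base_limit_system : limit_base N limit_system.
Proof.
have ker0 := base_kernel_trivial.
split; first split.
- exists (limit_nbhs setT 0 (0%N, fun _ _ _ => 1) 0), setT, 0%N.
  exists (0%N, fun _ _ _ => 1), 0%N; split=> //; first exact: filterT.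
  exact: unitary1.
- move=> _ _ [U [n [z [e [NU uz ->]]]]] [U' [n' [z' [e' [NU' uz' ->]]]]].
  have [z'' uz'' sub] := limit_nbhs_inter U U' n n' e e' uz uz'.
  exists (limit_nbhs (U `&` U') (maxn n n') z'' (maxn e e')) => //.
  by exists (U `&` U'), (maxn n n'), z'', (maxn e e'); split=> //; exact: filterI.
- by move=> _ [U [n [z [e [NU uz ->]]]]]; exact: limit_nbhs_zero.
- move=> _ [U [n [z [e [NU uz ->]]]]]; have [V NV VU] := nbhs0_split grN NU.
  exists (limit_nbhs V n.+1 z e.+1); first by exists V, n.+1, z, e.+1.
  exact: limit_nbhs_add.
- move=> U NU; exists (limit_nbhs U 0 (0%N, fun _ _ _ => 1) 0).
    exists U, 0%N, (0%N, fun _ _ _ => 1), 0%N; split=> //; exact: unitary1.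
  (* The [k i] are natural numbers of total 0, so they all vanish: no new neighbourhood of 0 appears
     on [X]. *)
  move=> y v /ker0 ->; rewrite addr0 => -[k [L [_ _ /= Uk sum0 _]]].
  move: Uk; rewrite big1 ?subr0 // => i _.
  have : (k i <= \sum_(i < L) k i)%N by rewrite (bigD1 i) //=; exact: leq_addr.
  have -> : (\sum_(i < L) k i)%N = 0%N.
    by move/esym/eqP: sum0; rewrite oppr_eq0 => /eqP[].
  by rewrite leqn0 => /eqP ->.
- move=> _ [U [n [z [e [NU uz ->]]]]]; apply: filterS NU => y Uy.
  exists (fun=> 0%N), 0%N; split=> //; rewrite ?big_ord0 ?subr0 ?oppr0 //.
  apply: filterE => j; apply: filterE => M l _.
  by rewrite big_ord0 subrr normr0 exprn_gt0 // invr_gt0.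
- by move=> _ [U [n [z [e [NU uz ->]]]]]; exact: limit_nbhs_limit.
- by move=> y /ker0 [].
Qed.

End Base.

Theorem limit_base_exists (X : zmodType) (N : set_system X) : group_nbhs0 N ->
  (forall x, (forall U, N U -> U x) -> x = 0) ->
  (forall n, (0 < n)%N -> exists2 U, N U & ~ tbounded n U) ->
  exists BB, limit_base N BB.
Proof.
move=> grN sepN ntb; have [x xP] := generic_sequence grN.
have [UU [ultraUU sub]] := ultraFilterLemma eventually_filter.
exists (limit_system N UU x); apply: limit_base_limit_system => // n.
by apply: sub; exists n.
Qed.

(** * Hausdorff quotients of semigroup topologies *)

Section Kernel.
Variables (G : zmodType) (BB : set_system G).
Hypothesis sgBB : semigroup_base BB.

Lemma base_kernel0 : base_kernel BB 0.
Proof. by move=> B /(base_zero sgBB) B0; exists 0, 0; rewrite subr0. Qed.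

Lemma base_kernelN u : base_kernel BB u -> base_kernel BB (- u).
Proof. by move=> Ku B /Ku[v [w [Bv Bw ->]]]; exists w, v; rewrite opprB. Qed.

Lemma base_kernelD u v :
  base_kernel BB u -> base_kernel BB v -> base_kernel BB (u + v).
Proof.
move=> Ku Kv B /(base_add sgBB)[C BC CB].
have [a [b [Ca Cb ->]]] := Ku C BC; have [c [d [Cc Cd ->]]] := Kv C BC.
by exists (a + c), (b + d); split; [exact: CB|exact: CB|zmodule].
Qed.

Definition coset_repr (g : G) : G := xget 0 [set h | base_kernel BB (g - h)].

Lemma coset_reprP g : base_kernel BB (g - coset_repr g).
Proof.
rewrite /coset_repr.
apply: (@xgetI _ 0 [set h | base_kernel BB (g - h)] g) => /=.
by rewrite subrr; exact: base_kernel0.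
Qed.

Lemma eq_coset_repr g h : base_kernel BB (g - h) -> coset_repr g = coset_repr h.
Proof.
move=> Kgh; congr xget; apply/seteqP; split=> k /= K.
  have := base_kernelD (base_kernelN Kgh) K; congr base_kernel; zmodule.
have := base_kernelD Kgh K; congr base_kernel; zmodule.
Qed.

End Kernel.

(** Cosets are represented by the fixed points of [coset_repr]. The base axioms are a parameter of
    the type because its group and topological structures depend on them. *)
Definition semigroup_quotient (G : zmodType) (BB : set_system G)
    of semigroup_base BB : Type :=
  {g : G | coset_repr BB g == g}.

Section Quotient.
Variables (G : zmodType) (BB : set_system G).
Hypothesis sgBB : semigroup_base BB.
Local Notation Q := (semigroup_quotient sgBB).
Local Notation K := (base_kernel BB).

HB.instance Definition _ := Choice.on Q.

Fact coset_repr_idem g : coset_repr BB (coset_repr BB g) == coset_repr BB g.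
Proof.
apply/eqP; apply: (eq_coset_repr sgBB).
by rewrite -opprB; apply: base_kernelN; exact: coset_reprP.
Qed.

Definition qpi (g : G) : Q := exist _ (coset_repr BB g) (coset_repr_idem g).
Definition qval (u : Q) : G := sval u.

Lemma qpiK u : qpi (qval u) = u.
Proof. by apply: val_inj; apply/eqP; exact: (svalP u). Qed.

Lemma qpi_eq g h : qpi g = qpi h <-> K (g - h).
Proof.
split=> [/(congr1 qval)|Kgh]; last by apply: val_inj; exact: eq_coset_repr.
rewrite /qval /= => eqgh.
have := base_kernelD sgBB (coset_reprP sgBB g) (base_kernelN (coset_reprP sgBB h)).
by congr K; rewrite eqgh; zmodule.
Qed.

Lemma qvalK g : K (qval (qpi g) - g).
Proof. by rewrite -opprB; apply: base_kernelN; exact: coset_reprP. Qed.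

Let qone := qpi 0.
Let qinv u := qpi (- qval u).
Let qmul u v := qpi (qval u + qval v).

Lemma qpiD g h : qmul (qpi g) (qpi h) = qpi (g + h).
Proof.
apply/qpi_eq; have := base_kernelD sgBB (qvalK g) (qvalK h).
by congr K; zmodule.
Qed.

Lemma qpi_surj u : exists g, u = qpi g.
Proof. by exists (qval u); rewrite qpiK. Qed.

Let qmulA : associative qmul.
Proof.
move=> u v w; have [[g ->] [h ->] [k ->]] := And3 (qpi_surj u) (qpi_surj v) (qpi_surj w).
by rewrite !qpiD addrA.
Qed.

Let qmul1 : left_id qone qmul.
Proof. by move=> u; have [g ->] := qpi_surj u; rewrite qpiD add0r. Qed.

Let qmulC : commutative qmul.
Proof. by move=> u v; rewrite /qmul addrC. Qed.

Let qmulr1 : right_id qone qmul.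
Proof. by move=> u; rewrite qmulC qmul1. Qed.

Let qmulV : left_inverse qone qinv qmul.
Proof. by move=> u; rewrite -[X in qmul _ X]qpiK qpiD addNr. Qed.

Let qmulrV : right_inverse qone qinv qmul.
Proof. by move=> u; rewrite qmulC qmulV. Qed.

HB.instance Definition _ := isGroup.Build Q qmulA qmul1 qmulr1 qmulV qmulrV.

Definition qnbhs (u : Q) : set_system Q :=
  [set A | exists2 B, BB B & forall b, B b -> A (qpi (qval u + b))].

HB.instance Definition _ := hasNbhs.Build Q qnbhs.

Lemma qnbhsE g (A : set Q) :
  nbhs (qpi g) A <-> exists2 B, BB B & forall b, B b -> A (qpi (g + b)).
Proof.
have eqg b : qpi (qval (qpi g) + b) = qpi (g + b).
  by apply/qpi_eq; have := qvalK g; congr K; zmodule.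
by split=> -[B BB_B BA]; exists B => // b /BA; rewrite eqg.
Qed.

Let qnbhs_filter (u : Q) : ProperFilter (nbhs u).
Proof.
split=> [[B /(base_zero sgBB) B0 /(_ _ B0)]//|]; split.
- by have [B BB_B] := base_nonempty sgBB; exists B.
- move=> P R [B BB_B BP] [C BB_C CR]; have [D BB_D DBC] := base_inter sgBB BB_B BB_C.
  by exists D => // b /DBC[/BP Pb /CR Rb].
- by move=> P R PR [B BB_B BP]; exists B => // b /BP/PR.
Qed.

Let qnbhs_singleton (u : Q) (A : set Q) : nbhs u A -> A u.
Proof.
by move=> [B /(base_zero sgBB) B0 /(_ _ B0)]; rewrite addr0 qpiK.
Qed.

Let qnbhs_nbhs (u : Q) (A : set Q) : nbhs u A -> nbhs u (nbhs^~ A).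
Proof.
move=> [B /(base_add sgBB)[C BB_C CB] BA]; exists C => // c Cc.
by apply/qnbhsE; exists C => // c' Cc'; rewrite -addrA; apply: BA; exact: CB.
Qed.

HB.instance Definition _ :=
  Nbhs_isNbhsTopological.Build Q qnbhs_filter qnbhs_singleton qnbhs_nbhs.

Let qmul_continuous : continuous (fun xy : Q * Q => (xy.1 * xy.2)%g).
Proof.
move=> [u v] A /=; have [[g ->] [h ->]] := conj (qpi_surj u) (qpi_surj v).
rewrite (_ : (qpi g * qpi h)%g = qpi (g + h)); last exact: qpiD.
move=> /qnbhsE[B /(base_add sgBB)[C BB_C CB] BA].
exists ([set w | exists2 c, C c & w = qpi (g + c)],
        [set w | exists2 c, C c & w = qpi (h + c)]) => /=.
  by split; apply/qnbhsE; exists C => // c Cc; exists c.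
move=> [w w'] /= [[c Cc ->] [c' Cc' ->]].
rewrite (_ : (_ * _)%g = qpi (g + h + (c + c'))); first by apply: BA; exact: CB.
by rewrite [LHS]qpiD; congr qpi; zmodule.
Qed.

HB.instance Definition _ := isParatopologicalGroup.Build Q qmul_continuous.

(** If [g + C] and [h + C] meet modulo the kernel, which lies in [C - C], then [g - h] lies in
    [(C + C) - (C + C)], hence in [B - B]. *)
Lemma semigroup_quotient_hausdorff : hausdorff_space Q.
Proof.
move=> u v; have [[g ->] [h ->]] := conj (qpi_surj u) (qpi_surj v) => clgh.
apply/qpi_eq => B /(base_add sgBB)[C BB_C CB].
have [||w [[c Cc ->] [c' Cc' /qpi_eq/(_ C BB_C)[a [b [Ca Cb eqab]]]]]] :=
    clgh [set w | exists2 c, C c & w = qpi (g + c)]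
         [set w | exists2 c, C c & w = qpi (h + c)].
- by apply/qnbhsE; exists C => // c Cc; exists c.
- by apply/qnbhsE; exists C => // c Cc; exists c.
exists (a + c'), (b + c); split; [exact: CB|exact: CB|].
rewrite (_ : a + c' - (b + c) = (a - b) + (c' - c)); last by zmodule.
by rewrite -eqab; zmodule.
Qed.

Lemma qpi_mul g h : (qpi g * qpi h)%g = qpi (g + h).
Proof. exact: qpiD. Qed.

End Quotient.

(** * Non-closed embeddings obtained from a limit base *)

Definition additive_group (X : topologicalGroupType)
  (XC : forall x y : X, commute x y) : Type := X.

Section Additive.
Variables (X : topologicalGroupType) (XC : forall x y : X, commute x y).
Local Notation A := (additive_group XC).

HB.instance Definition _ := Choice.copy A X.
HB.instance Definition _ := @GRing.isZmodule.Build A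
  (1%g : X) (fun x : X => x^-1)%g (fun x y : X => x * y)%g
  (@mulgA X) XC (@mul1g X) (@mulVg X).

Lemma mulrn_additive_group (x : A) n : x *+ n = ((x : X) ^+ n)%g.
Proof. by elim: n => // n IHn; rewrite mulrS IHn expgS. Qed.

Definition nbhs_unit : set_system A := nbhs (1%g : X).

Lemma group_nbhs0_unit : group_nbhs0 nbhs_unit.
Proof.
split.
- exact: nbhs_filter.
- by move=> U; exact: nbhs_singleton.
- by move=> U /nbhs1_split.
- move=> U NU; have := @invg_continuous X 1%g U; rewrite invg1; exact.
Qed.

Lemma nbhs_translate (x : A) (U : set A) :
  nbhs (x : X) U <-> nbhs_unit [set t | U (x + t)].
Proof.
have mulg_cvg (a b : X) : (fun t : X => (a * t)%g) @ b --> (a * b)%g.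
  apply: (@cvg_comp _ _ _ (fun t : X => (a, t)) (fun xy : X * X => (xy.1 * xy.2)%g)
    _ (nbhs (a, b))); last exact: (@mulg_continuous X (a, b)).
  exact: (cvg_pair (cvg_cst a) cvg_id).
split=> [xU|NU].
  by have := mulg_cvg x 1%g; rewrite mulg1; apply.
have := mulg_cvg (x : X)^-1%g x; rewrite mulVg => /(_ _ NU) xU.
have {}xU : nbhs (x : X) [set t : X | U ((x : X) * ((x : X)^-1 * t))%g] by exact: xU.
by apply: filterS xU => t /=; rewrite mulVKg.
Qed.

Hypothesis X_hausdorff : hausdorff_space X.

Lemma nbhs_unit_separated (x : A) : (forall U, nbhs_unit U -> U x) -> x = 0.
Proof.
move=> xU; apply: X_hausdorff => P R xP R1; exists (x : X); split.
  exact: nbhs_singleton.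
exact: xU.
Qed.

Lemma limit_base_not_closed BB : limit_base nbhs_unit BB ->
  exists (Y : paratopologicalGroupType) (f : X -> Y),
    [/\ hausdorff_space Y, topological_subgroup_embedding f & ~ closed (range f)].
Proof.
move=> lim; have sgBB := limit_base_semigroup lim.
have grN := group_nbhs0_unit; have filterN : Filter nbhs_unit := nbhs0_filter grN.
pose q := qpi sgBB; pose f (x : X) := q (x : A, 0).
exists (semigroup_quotient sgBB), f; split.
- exact: semigroup_quotient_hausdorff.
- split.
  + by move=> x y; rewrite /f [RHS]qpi_mul.
  + move=> x y /qpi_eq Kxy.
    suff : (x : A) - (y : A) = 0 by move=> /eqP; rewrite subr_eq0 => /eqP.
    apply: nbhs_unit_separated => U NU.
    have [B BB_B BU] := base_induced lim NU.
    apply: (BU _ _ (base_kernelN Kxy)).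
    rewrite (_ : (_, 0) = ((x : A), 0) - ((y : A), 0)) ?subrr //.
    exact: (base_zero sgBB).
  + move=> U; split=> [openU|[V openV ->]]; last first.
      apply: open_comp openV => x _ W /qnbhsE[B BB_B BW].
      apply/nbhs_translate; apply: filterS (base_nbhs lim BB_B) => t /= /BW.
      by congr W; congr (qpi _ _).
    (* The largest set with trace in [U]; its interior has trace exactly [U]. *)
    pose W : set (semigroup_quotient sgBB) := [set w | forall x, f x = w -> U x].
    exists (W°)%classic; first exact: open_interior.
    apply/seteqP; split=> [x Ux|x /interior_subset]; last exact.
    apply/qnbhsE; have /nbhs_translate NU : nbhs x U by exact: open_nbhs_nbhs.
    have [B BB_B BU] := base_induced lim NU; exists B => // b Bb y /qpi_eq Kyb.
    have : U ((x : A) + ((y : A) - (x : A))).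
      apply: (BU _ _ (base_kernelN Kyb)); move: Bb; congr B.
      rewrite (_ : (_, 0) = ((y : A), 0 : int) - ((x : A), 0)) //.
      by zmodule.
    by rewrite addrC subrK.
(* The class of [(0, 1)] is in the closure, since [(0, 1) + (a, -1)] comes from [X], and is kept out
   of the image by [base_new]. *)
move=> /(_ (q (0, 1))) cl.
have [x _ fx] : range f (q (0, 1)).
  apply: cl => W /qnbhsE[B BB_B BW]; have [a Ba] := base_limit lim BB_B.
  exists (f a); split; first by exists a.
  by have := BW _ Ba; congr W; congr (qpi _ _); congr pair; rewrite add0r.
move/qpi_eq: fx => /base_kernelN Kx; apply: (base_new lim (x := - (x : A))).
move: Kx; rewrite opprB; congr base_kernel; apply/eqP; rewrite xpair_eqE /=.
by rewrite sub0r subr0 !eqxx.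
Qed.

End Additive.

(** * Complete groups *)

Lemma complete_group_cvg (X : topologicalGroupType) : complete_group X ->
  forall F : set_system X, ProperFilter F -> @cauchy (two_sided X) F ->
  exists l : X, F --> l.
Proof.
move=> cX F FF cF; exists (lim (F : set_system (two_sided X))).
exact: cX FF cF.
Qed.

Section Cauchy.
Variables (X : topologicalGroupType) (XC : forall x y : X, commute x y).
Local Notation A := (additive_group XC).
Local Notation N := (@nbhs_unit X XC).

(** Commutativity makes the left and right uniformities agree, and halving [U] passes from a common
    centre [x] to pairs. *)
Lemma two_sided_cauchyP (F : set_system (two_sided X)) : ProperFilter F ->
  cauchy F <-> forall U, N U -> exists x : A, F [set a | U (x - (a : A))].
Proof.
move=> FF; have grN := group_nbhs0_unit XC; have FN := nbhs0_filter grN; split.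
  move=> cF U NU.
  have [] := cF [set xy : X * X | U (xy.1^-1 * xy.2)%g /\ U (xy.1 * xy.2^-1)%g].
    by exists U.
  move=> [P R] /= [FP FR] PRU; have [x Px] := filter_ex FP.
  exists x; apply: filterS FR => a Ra.
  by have [] := PRU (x, a) (conj Px Ra).
move=> cF E [U NU UE]; have [V [NV Vsym VU]] := nbhs0_split_sym grN NU.
have [x Fx] := cF V NV; exists ([set a : two_sided X | V (x - (a : A))],
  [set a : two_sided X | V (x - (a : A))]) => //.
have diff (a b : A) : V (x - a) -> V (x - b) -> U (a - b).
  by move=> Va Vb; have := VU _ _ Vb (Vsym _ Va); congr U; zmodule_in (additive_group XC).
move=> [a b] /= [Va Vb]; apply: UE => /=; split; last exact: diff.
by have := diff b a Vb Va; rewrite addrC.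
Qed.

(** The pair [(x, n)] stands for [x + n y] with [y] the limit of [F]; its smallness is tested by
    substituting [a] for [y] along [F]. *)
Definition cauchy_nbhs (F : set_system A) (U : set A) : set (A * int) :=
  [set p | F [set a | U (p.1 + a *~ p.2)]].

(** If [(x, 1)] were in the kernel, [x + a] would tend to 0 along [F], which would converge to
    [- x]. The kernel can still be nonzero, as a multiple of the new point may lie in [X]. *)
Lemma cauchy_limit_base (F : set_system A) : ProperFilter F ->
  (forall U, N U -> exists x, F [set a | U (x - a)]) ->
  (forall l : X, ~ (F : set_system X) --> l) ->
  limit_base N [set B | exists2 U, N U & B = cauchy_nbhs F U].
Proof.
move=> FF cF ncF; have grN := group_nbhs0_unit XC; have FN := nbhs0_filter grN.
set BB := [set B | _].
have addB U V : (forall x y, V x -> V y -> U (x + y)) ->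
    forall u v, cauchy_nbhs F V u -> cauchy_nbhs F V v -> cauchy_nbhs F U (u + v).
  move=> VU u v; apply: filterS2 => a Vu Vv; have := VU _ _ Vu Vv; congr U.
  by rewrite (_ : (u + v).1 = u.1 + v.1) // (_ : (u + v).2 = u.2 + v.2) // mulrzDr; zmodule.
have oppB V : (forall x, V x -> V (- x)) ->
    forall u, cauchy_nbhs F V u -> cauchy_nbhs F V (- u).
  move=> Vsym u; apply: filterS => a /Vsym; congr V.
  by rewrite (_ : (- u).1 = - u.1) // (_ : (- u).2 = - u.2) // mulrNz opprD.
have ker u : base_kernel BB u -> forall U, N U -> cauchy_nbhs F U u.
  move=> Ku U NU; have [V [NV Vsym VU]] := nbhs0_split_sym grN NU.
  have [|v [w [Vv Vw ->]]] := Ku (cauchy_nbhs F V); first by exists V.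
  by apply: (addB U V) => //; exact: oppB.
split; first split.
- by exists (cauchy_nbhs F setT), setT => //; exact: filterT.
- move=> _ _ [U NU ->] [V NV ->]; exists (cauchy_nbhs F (U `&` V)).
    by exists (U `&` V) => //; exact: filterI.
  by move=> u UVu; split; apply: filterS UVu => a [].
- move=> _ [U NU ->]; apply: filterE => a /=.
  by rewrite mulr0z addr0; exact: (nbhs0_mem grN).
- move=> _ [U NU ->]; have [V NV VU] := nbhs0_split grN NU.
  by exists (cauchy_nbhs F V); [exists V|exact: addB].
- move=> U NU; have [V [NV Vsym VU]] := nbhs0_split_sym grN NU.
  exists (cauchy_nbhs F V); first by exists V.
  move=> x v Kv Bxv.
  have : cauchy_nbhs F U (((x, 0) + v) + - v).
    by apply: (addB U V) => //; apply: oppB => //; exact: ker.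
  rewrite addrK => /filter_ex[a] /=.
  by rewrite mulr0z addr0.
- move=> _ [U NU ->]; apply: filterS NU => x Ux; apply: filterE => a /=.
  by rewrite mulr0z addr0.
- move=> _ [U NU ->]; have [x Fx] := cF U NU; exists x.
  by apply: filterS Fx => a; rewrite /= mulrNz mulr1z.
move=> x /ker Kx; apply: (ncF (- x : A)) => W /(nbhs_translate (XC := XC)) NW.
apply: filterS (Kx _ NW) => a /=; rewrite mulr1z addrA.
by rewrite addNr add0r.
Qed.

(** Finitely many translates of a small set cover the powers and, slightly enlarged, their closure;
    so each ultrafilter on the closure is Cauchy, and completeness gives its limit. *)
Lemma tbounded_compact (n : nat) : complete_group X ->
  (forall U, N U -> @tbounded A n U) ->
  compact (closure (range (fun x : X => (x ^+ n)%g))).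
Proof.
move=> cX tb; have grN := group_nbhs0_unit XC; have FN := nbhs0_filter grN.
rewrite compact_ultra => F ultraF FR.
suff [l Fl] : exists l : X, F --> l.
  exists l; split=> //.
  apply: closed_closure => W /Fl FW; have [y [Ry Wy]] := filter_ex (filterI FR FW).
  by exists y.
suff cF : @cauchy (two_sided X) F.
  exact: (complete_group_cvg cX (@ultra_proper _ F ultraF) cF).
apply/two_sided_cauchyP => U NU.
have [V [NV Vsym VU]] := nbhs0_split_sym grN NU.
have [W [NW Wsym WV]] := nbhs0_split_sym grN NV.
have [S SP] := tb W NW.
(* The [.+1] provides [ord0] as a default colour outside the closure. *)
have close (y : X) : exists j : 'I_(size S).+1,
    closure (range (fun x : X => (x ^+ n)%g)) y -> U (S`_j - (y : A)).
  have [cly|ncly] := pselect (closure (range (fun x : X => (x ^+ n)%g)) y); last by exists ord0.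
  have yW : nbhs (y : X) [set t : X | W (- (y : A) + (t : A))].
    apply/(nbhs_translate (XC := XC)); apply: filterS NW => t Wt /=.
    by rewrite addKr.
  have [_ [[x _ <-] Wx]] := cly _ yW.
  have [f fS Wf] := SP (x : A).
  have lt_f : (index f S < (size S).+1)%N by rewrite ltnS ltnW // index_mem.
  exists (Ordinal lt_f) => _; rewrite /= nth_index //.
  have := VU _ _ (WV _ _ (Wsym _ Wf) Wx) (nbhs0_mem grN NV); congr U.
  by rewrite mulrn_additive_group; zmodule_in (additive_group XC).
have [c cP] := choice close; have [j Fj] := ultra_colour c ultraF.
exists S`_j; apply: filterS2 FR Fj => y cly <-; exact: cP.
Qed.

End Cauchy.

(** * Closedness from completeness and compact exponent *)

Section ClosedImage.
Variables (X : topologicalGroupType) (Y : paratopologicalGroupType) (f : X -> Y).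
Local Open Scope group_scope.
Hypothesis Y_hausdorff : hausdorff_space Y.
Hypothesis f_emb : topological_subgroup_embedding f.
Hypothesis XC : forall x y : X, commute x y.

Let fM : {morph f : x y / x * y} := let: And3 h _ _ := f_emb in h.

Lemma embedding_one : f 1 = 1.
Proof. by apply: (mulgI (f 1)); rewrite -fM !mulg1. Qed.

Lemma embedding_exp x n : f (x ^+ n) = f x ^+ n.
Proof. by elim: n => [|n IHn]; rewrite ?embedding_one // !expgS fM IHn. Qed.

Lemma embedding_nbhs x (U : set X) : nbhs x U ->
  exists2 V, nbhs (f x) V & f @^-1` V `<=` U.
Proof.
have [_ _ fO] := f_emb; rewrite nbhsE => -[W [oW Wx] WU].
have /fO[V oV WV] := oW; exists V; last by rewrite -WV.
by apply: open_nbhs_nbhs; split=> //; move: Wx; rewrite WV.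
Qed.

Lemma embedding_continuous : continuous f.
Proof.
have [_ _ fO] := f_emb; apply/continuousP => V oV.
by apply/fO; exists V.
Qed.

Lemma expg_continuous n : continuous (fun y : Y => y ^+ n).
Proof.
elim: n => [|n IHn] y; first exact: cvg_cst.
rewrite /continuous_at expgS.
rewrite (_ : (fun y => _) = (fun y : Y => y * y ^+ n)); last first.
  by apply/funext => z; rewrite expgS.
apply: (@cvg_comp _ _ _ (fun z : Y => (z, z ^+ n)) (fun xy : Y * Y => xy.1 * xy.2)
    _ (nbhs (y, y ^+ n))); last exact: (@mulg_continuous Y (y, y ^+ n)).
by apply: cvg_pair; [exact: cvg_id|exact: IHn].
Qed.

Lemma complete_compact_exponent_closed :
  complete_group X -> compact_exponent X -> closed (range f).
Proof.
move=> cX [n n0 cpt] y cly.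
pose K := closure (range (fun x : X => x ^+ n)).
have clfK : closed (f @` K).
  apply: compact_closed => //; apply: continuous_compact => //.
  by apply: continuous_subspaceT; exact: embedding_continuous.
(* The compact image of [K] is closed in [Y], so it contains the limit [y ^+ n] of the
   [f x ^+ n]. *)
have [k _ kE] : (f @` K) (y ^+ n).
  apply: clfK => W yW; have [_ [[x _ <-] Wx]] := cly _ (expg_continuous yW).
  exists (f x ^+ n); split=> //; exists (x ^+ n); last exact: embedding_exp.
  by apply: subset_closure; exists x.
pose F : set_system (two_sided X) := [set P | exists2 V, nbhs y V & f @^-1` V `<=` P].
have FF : ProperFilter F.
  split=> [[V yV V0]|].
    by have [_ [[x _ <-] Vx]] := cly _ yV; apply: (V0 x).
  split.
  - by exists setT => //; exact: filterT.
  - move=> P R [V yV VP] [W yW WR]; exists (V `&` W); first exact: filterI.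
    by move=> x [/VP ? /WR].
  - by move=> P R PR [V yV VP]; exists V => // x /VP/PR.
have Fexp : (fun x : X => x ^+ n) @ (F : set_system X) --> k.
  move=> U /embedding_nbhs[V]; rewrite kE => /expg_continuous yV VU.
  by exists ((fun z => z ^+ n) @^-1` V) => // x Vx; apply: VU; rewrite /= embedding_exp.
(* This is the limit of [a * b ^+ n.-1 * (b ^+ n)^-1] as [a] and [b] tend to [y]; the inverse is
   taken at [k] in [X], where inversion is continuous. *)
have yk : y * y ^+ n.-1 * f k^-1 = 1.
  by rewrite -expgS prednK // -kE -fM mulgV embedding_one.
have cF : cauchy F.
  apply/(two_sided_cauchyP XC) => U NU.
  have [V V1 VU] := embedding_nbhs NU.
  rewrite embedding_one -yk in V1.
  have := @mulg_continuous Y (y * y ^+ n.-1, f k^-1) V V1.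
  move=> [[P R] /= [yP kR] PRV].
  have [[P1 P2] /= [yP1 yP2] P12] := @mulg_continuous Y (y, y ^+ n.-1) P yP.
  have kinv : nbhs k [set x : X | R (f x^-1)].
    apply: (@invg_continuous X k (f @^-1` R)); exact: embedding_continuous.
  have [_ [[a _ <-] P1a]] := cly _ yP1; exists a.
  have FP2 : F [set b | P2 (f b ^+ n.-1)].
    by exists ((fun z => z ^+ n.-1) @^-1` P2) => //; exact: expg_continuous.
  apply: (filterS _ (filterI FP2 (Fexp _ kinv))) => b [P2b Rb].
  apply: VU; have := PRV (f a * f b ^+ n.-1, f (b ^+ n)^-1).
  rewrite /= -embedding_exp -!fM (_ : a * b ^+ n.-1 * (b ^+ n)^-1 = a * b^-1).
    apply; split=> //; rewrite fM embedding_exp.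
    exact: (P12 (f a, f b ^+ n.-1)).
  by rewrite -{2}(prednK n0) expgS invgM mulgA mulgK.
have [l Fl] := complete_group_cvg cX FF cF.
(* The image of [F] converges both to [f l] and to [y]. *)
exists l => //; apply: Y_hausdorff => P Q lP yQ.
have [V yV VP] : F (f @^-1` P) by apply: Fl; exact: (embedding_continuous lP).
have [_ [[x _ <-] [Vx Qx]]] := cly _ (filterI yV yQ).
by exists (f x); split=> //; exact: VP.
Qed.

End ClosedImage.

Theorem mainTheorem4 (X : topologicalGroupType)
    (X_hausdorff : hausdorff_space X)
    (X_abelian : forall x y : X, commute x y) :
  (complete_group X /\ compact_exponent X)
  <->
  (forall (Y : paratopologicalGroupType) (f : X -> Y),
     hausdorff_space Y ->
     topological_subgroup_embedding f ->
     closed (range f)).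
Proof.
split=> [[cX ceX] Y f Y_hausdorff f_emb|closedX].
  exact: complete_compact_exponent_closed.
have no_base BB : ~ limit_base (@nbhs_unit X X_abelian) BB.
  move=> /(limit_base_not_closed X_hausdorff)[Y [f [Yh f_emb]]]; apply.
  exact: closedX.
have cX : complete_group X.
  move=> F FF cF; apply: contrapT => ncF.
  apply: (no_base _ (cauchy_limit_base (XC := X_abelian) FF _ _)).
    exact/two_sided_cauchyP.
  by move=> l Fl; apply: ncF; exact: (@cvgP (two_sided X) F l Fl).
split=> //; apply: contrapT => nce.
have [||BB] := limit_base_exists (group_nbhs0_unit X_abelian).
- exact: nbhs_unit_separated.
- move=> n n0; apply: contrapT => ntb; apply: nce; exists n => //.
  apply: (tbounded_compact (XC := X_abelian)) => // U NU.
  by apply: contrapT => nU; apply: ntb; exists U.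
exact: no_base.
Qed.
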